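(* Let $(M,\nabla)$ be an affine manifold and let $(M,g(t))$ be a Koszul soliton. Then the family of metrics $t\mapsto g^T(t/4)$ on the complex manifold $(TM,J_\nabla)$, where $g^T(s):=(g(s))^T$, is a Kähler-Ricci soliton.
   Context: An affine manifold (also called flat manifold) $(M,\nabla)$ is a smooth manifold with a connection $\nabla$ whose torsion and curvature vanish. Around every point there are affine coordinate systems $\{x^1,\dots,x^n\}$, i.e. local coordinates with $\nabla_{\partial/\partial x^i}\partial/\partial x^j=0$; coordinate changes between them are affine transformations. A map between affine manifolds is affine if it is an affine map in local affine coordinates. A Riemannian metric $g$ on $(M,\nabla)$ is Hessian if locally $g=\nabla d\varphi$, i.e. $g_{ij}=\partial^2\varphi/\partial x^i\partial x^j$ in affine coordinates. The second Koszul form $\beta(g)$ of a Hessian metric $g$ is given in affine coordinates by $\beta_{ij}=\frac12\,\frac{\partial^2\log\det[g_{pq}]}{\partial x^i\partial x^j}$. The Hesse-Koszul flow is $\frac{\partial}{\partial t}g(t)=2\beta(g(t))$, $g(0)=g_0$, for Hessian metrics $g(t)$ on $M$, $t\in[0,T)$, $0<T\le\infty$. A Koszul soliton $(M,g(t))$ is a solution of the Hesse-Koszul flow such that $g(t)=\sigma(t)\,\varphi_t^*g(0)$, where $\varphi_t:M\to M$ is a family of affine bijections, depending smoothly on $t$, with $\varphi_0=\mathrm{id}$, and $\sigma(t)$ is a smooth scale function with $\sigma(0)=1$. Let $\pi:TM\to M$ be the tangent bundle. Given affine coordinates $\{x^1,\dots,x^n\}$ on an open subset of $M$, put $\xi^j=x^j\circ\pi$,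 $\xi^{n+j}=dx^j$ (the $j$-th fibre coordinate) and $z^j=\xi^j+\sqrt{-1}\,\xi^{n+j}$. The $\{z^1,\dots,z^n\}$ are holomorphic coordinates defining a complex structure $J_\nabla$ on $TM$. For a Riemannian metric $g$ on $M$, $g^T=\sum_{i,j}(g_{ij}\circ\pi)\,dz^id\bar z^j$ is a Hermitian metric on $(TM,J_\nabla)$, with components $g^T_{i\bar j}=g_{ij}\circ\pi$; it is Kähler when $g$ is Hessian. On a complex manifold, a Kähler-Ricci soliton is a family $h(t)$ of Kähler metrics with $h(t)=\sigma(t)\psi_t^*h(0)$, where $\psi_t$ is a family of biholomorphisms depending smoothly on $t$ with $\psi_0=\mathrm{id}$ and $\sigma$ is a smooth scale function with $\sigma(0)=1$, that solves the Kähler-Ricci flow $\frac{\partial}{\partial t}h_{i\bar j}=-R_{i\bar j}(h(t))$, where $R_{i\bar j}(h)=-\frac{\partial^2}{\partial z^i\partial\bar z^j}\log\det[h_{p\bar q}]$ is the Ricci tensor. *)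

(* Defs.v *)
From HB Require Import structures.
From mathcomp Require Import all_boot all_order all_algebra.
From mathcomp Require Import complex.
From mathcomp Require Import all_classical all_reals all_analysis.

Set Implicit Arguments.
Unset Strict Implicit.
Unset Printing Implicit Defensive.

Import Order.TTheory GRing.Theory Num.Theory.
Import numFieldNormedType.Exports.

Local Open Scope classical_set_scope.
Local Open Scope ring_scope.
Local Open Scope complex_scope.

(** * Calculus *)

Section Calculus.
Context {R : realType}.

(* iter_derive [:: v1; ...; vk] f = D_v1 (... (D_vk f)) *)
Definition iter_derive {V W : normedModType R} (s : seq V) (f : V -> W) : V -> W :=
  foldr (fun v h x => 'D_v h x) f s.

(* C^infty on an open subset U of a finite-dimensional space V. *)
Definition smooth_on {V W : normedModType R} (U : set V) (f : V -> W) : Prop :=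
  forall (s : seq V) (x : V), U x -> differentiable (iter_derive s f) x.

(* Smoothness on a set that need not be open (typically [0, T)): local
   existence of smooth extensions. *)
Definition smooth_within {V W : normedModType R} (A : set V) (f : V -> W) : Prop :=
  forall x, A x -> exists (U : set V) (F : V -> W),
    [/\ open U, U x, smooth_on U F & forall y, U y -> A y -> F y = f y].

Definition partial {n} (i : 'I_n) (f : 'rV[R]_n -> R) : 'rV[R]_n -> R :=
  fun x => 'D_(delta_mx 0 i) f x.

(* f'(t) = l, where f matters only on I; one-sided at an endpoint of I. *)
Definition is_deriv_within (I : set R) (f : R -> R) (t l : R) : Prop :=
  (fun s => (f s - f t) / (s - t)) @ within I (dnbhs t) --> l.

Definition is_derivC_within (I : set R) (f : R -> R[i]) (t : R) (l : R[i]) : Prop :=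
  is_deriv_within I (fun s => complex.Re (f s)) t (complex.Re l) /\
  is_deriv_within I (fun s => complex.Im (f s)) t (complex.Im l).

(* The time interval [0, T), with T possibly infinite. *)
Definition time (T : \bar R) : set R := [set t | 0 <= t /\ (t%:E < T)%E].

End Calculus.

(** * Calculus on C^n

   C^n is modelled by R^(n + n), a row (x, y) standing for z = x + i y. *)

Section ComplexCalculus.
Context {R : realType}.

Definition zcoord {n} (k : 'I_n) (w : 'rV[R]_(n + n)) : R[i] :=
  lsubmx w 0 k +i* rsubmx w 0 k.

Definition deriveC {n} (v : 'rV[R]_(n + n)) (F : 'rV[R]_(n + n) -> R[i])
    (w : 'rV[R]_(n + n)) : R[i] :=
  ('D_v (fun y => complex.Re (F y)) w) +i* ('D_v (fun y => complex.Im (F y)) w).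

Definition dx {n} (j : 'I_n) := @deriveC n (row_mx (delta_mx 0 j) 0).
Definition dy {n} (j : 'I_n) := @deriveC n (row_mx 0 (delta_mx 0 j)).

Definition dz {n} (j : 'I_n) (F : 'rV[R]_(n + n) -> R[i]) (w : 'rV[R]_(n + n)) : R[i] :=
  (dx j F w - (0 +i* 1) * dy j F w) / 2%:R.

Definition dzbar {n} (j : 'I_n) (F : 'rV[R]_(n + n) -> R[i]) (w : 'rV[R]_(n + n)) : R[i] :=
  (dx j F w + (0 +i* 1) * dy j F w) / 2%:R.

Definition holomorphic_on {n m} (U : set 'rV[R]_(n + n))
    (F : 'rV[R]_(n + n) -> 'rV[R]_(m + m)) : Prop :=
  smooth_on U F /\
  forall w, U w -> forall j k, dzbar j (fun y => zcoord k (F y)) w = 0.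

(* The matrix (d w^b / d z^a)_(a, b) of w = F(z). *)
Definition jacobianC {n m} (F : 'rV[R]_(n + n) -> 'rV[R]_(m + m))
    (w : 'rV[R]_(n + n)) : 'M[R[i]]_(n, m) :=
  \matrix_(a, b) dz a (fun y => zcoord b (F y)) w.

Definition adjmx {m n} (A : 'M[R[i]]_(m, n)) : 'M[R[i]]_(n, m) := map_mx conjc A^T.

End ComplexCalculus.

(** * Smooth manifolds *)

(* The values of cmap outside cdom, and of cinv outside cmap @` cdom, are
   irrelevant. *)
Record chart (R : realType) (X : topologicalType) (m : nat) := Chart {
  cdom : set X;
  cmap :> X -> 'rV[R]_m;
  cinv : 'rV[R]_m -> X }.

Section Charts.
Context {R : realType} {X : topologicalType} {m : nat}.
Implicit Types c d : chart R X m.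

Definition cimg c : set 'rV[R]_m := c @` cdom c.

Definition is_chart c : Prop :=
  [/\ open (cdom c), open (cimg c),
      forall p, cdom c p -> cinv c (c p) = p,
      forall p, cdom c p -> {for p, continuous c} &
      forall x, cimg c x -> {for x, continuous (cinv c)}].

Definition transition c d : 'rV[R]_m -> 'rV[R]_m := d \o cinv c.

Definition smooth_transition c d : Prop :=
  smooth_on (c @` (cdom c `&` cdom d)) (transition c d).

(* f read in the charts c (source) and d (target) *)
Definition local_expr c d (f : X -> X) : 'rV[R]_m -> 'rV[R]_m := d \o f \o cinv c.

(* (t, p) |-> f t p is smooth on I x X, X having the smooth structure given by
   the charts in A. *)
Definition smooth_family (A : set (chart R X m)) (I : set R) (f : R -> X -> X) : Prop :=
  forall t p c d, I t -> A c -> A d -> cdom c p -> cdom d (f t p) ->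
  exists (W : set (R * 'rV[R]_m)) (F : R * 'rV[R]_m -> 'rV[R]_m),
    [/\ open W, W (t, c p), smooth_on W F &
        forall s x, W (s, x) -> I s ->
          [/\ cimg c x, cdom d (f s (cinv c x)) & F (s, x) = local_expr c d (f s) x]].

End Charts.

(* n-dimensional smooth manifold, with its maximal atlas. *)
Record smooth_manifold (R : realType) (n : nat) := SmoothManifold {
  sm_space :> topologicalType;
  sm_hausdorff : hausdorff_space sm_space;
  sm_second_countable : @second_countable sm_space;
  atlas : set (chart R sm_space n);
  atlas_chart : forall c, atlas c -> is_chart c;
  atlas_cover : forall p, exists2 c, atlas c & cdom c p;
  atlas_smooth : forall c d, atlas c -> atlas d -> smooth_transition c d;
  atlas_maximal : forall c, is_chart c ->
    (forall d, atlas d -> smooth_transition c d /\ smooth_transition d c) -> atlas c }.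

(** * Connections and affine manifolds *)

(* A connection is given by its Christoffel symbols in all charts:
   christoffel c x k i j = Gamma^k_ij at the point of coordinates x, where
   nabla_(d/dx^i) (d/dx^j) = \sum_k Gamma^k_ij d/dx^k. *)
Record connection (R : realType) (n : nat) (M : smooth_manifold R n) := Connection {
  christoffel : chart R M n -> 'rV[R]_n -> 'I_n -> 'I_n -> 'I_n -> R;
  christoffel_smooth : forall c, atlas c -> forall k i j,
    smooth_on (cimg c) (fun x => christoffel c x k i j);
  christoffel_change : forall c d, atlas c -> atlas d ->
    forall p, cdom c p -> cdom d p -> forall i j a : 'I_n,
    let y b := fun x => transition c d x 0 b in
    let x := c p in
    \sum_k christoffel c x k i j * partial k (y a) x =
    \sum_b \sum_e christoffel d (d p) a b e * partial i (y b) x * partial j (y e) x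
      + partial i (partial j (y a)) x }.

Section Curvature.
Context {R : realType} {n : nat} {M : smooth_manifold R n} (nabla : connection M).
Local Notation Gamma c k i j := (fun x => christoffel nabla c x k i j).

(* T(d_i, d_j) = \sum_k torsion k i j d_k *)
Definition torsion (c : chart R M n) (x : 'rV[R]_n) (k i j : 'I_n) : R :=
  Gamma c k i j x - Gamma c k j i x.

(* R(d_i, d_j) d_k = \sum_l curvature l k i j d_l *)
Definition curvature (c : chart R M n) (x : 'rV[R]_n) (l k i j : 'I_n) : R :=
  partial i (Gamma c l j k) x - partial j (Gamma c l i k) x
  + \sum_m (Gamma c l i m x * Gamma c m j k x - Gamma c l j m x * Gamma c m i k x).

End Curvature.

Record affine_manifold (R : realType) (n : nat) := AffineManifold {
  am_mfd :> smooth_manifold R n;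
  am_conn : connection am_mfd;
  am_torsion_free : forall c, @atlas _ _ am_mfd c -> forall x, cimg c x ->
    forall k i j, torsion am_conn c x k i j = 0;
  am_flat : forall c, @atlas _ _ am_mfd c -> forall x, cimg c x ->
    forall l k i j, curvature am_conn c x l k i j = 0 }.

Section AffineGeometry.
Context {R : realType} {n : nat} (M : affine_manifold R n).

(* Affine coordinate systems. *)
Definition affine_chart (c : chart R M n) : Prop :=
  atlas c /\ forall x, cimg c x -> forall k i j, christoffel (am_conn M) c x k i j = 0.

Definition affine_map (f : M -> M) : Prop :=
  forall p, exists (c d : chart R M n) (U : set M) (A : 'M[R]_n) (b : 'rV[R]_n),
    [/\ affine_chart c, affine_chart d, open U /\ U p,
        U `<=` cdom c `&` f @^-1` cdom d &
        forall q, U q -> d (f q) = c q *m A + b].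

(* Components g_ij, as functions of the coordinates, of a covariant 2-tensor in
   each chart; they matter only on cimg c for c in the atlas. *)
Definition tensor2 := chart R M n -> 'rV[R]_n -> 'M[R]_n.

(* Vectors are rows: ('J f x) i a = d f^a / d x^i. *)
Definition riemannian_metric (g : tensor2) : Prop :=
  [/\ forall c, atlas c -> forall i j, smooth_on (cimg c) (fun x => g c x i j),
      forall c, atlas c -> forall x, cimg c x -> (g c x)^T = g c x,
      forall c, atlas c -> forall x, cimg c x ->
        forall v : 'rV[R]_n, v != 0 -> 0 < (v *m g c x *m v^T) 0 0 &
      forall c d, atlas c -> atlas d -> forall p, cdom c p -> cdom d p ->
        let J := 'J (transition c d) (c p) in
        g c (c p) = J *m g d (d p) *m J^T].

Definition hessian_metric (g : tensor2) : Prop :=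
  riemannian_metric g /\
  forall p, exists (c : chart R M n) (U : set 'rV[R]_n) (phi : 'rV[R]_n -> R),
    [/\ affine_chart c, cdom c p, [/\ open U, U (c p) & U `<=` cimg c],
        smooth_on U phi &
        forall x, U x -> forall i j, g c x i j = partial i (partial j phi) x].

(* Components of the second Koszul form in the affine chart c. *)
Definition koszul_form (g : tensor2) (c : chart R M n) (x : 'rV[R]_n) (i j : 'I_n) : R :=
  2^-1 * partial i (partial j (fun y => ln (\det (g c y)))) x.

Definition hesse_koszul_flow (T : \bar R) (g : R -> tensor2) : Prop :=
  (forall t, time T t -> hessian_metric (g t)) /\
  forall t c x i j, time T t -> affine_chart c -> cimg c x ->
    is_deriv_within (time T) (fun s => g s c x i j) t (2 * koszul_form (g t) c x i j).

(* h = s f^* g *)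
Definition is_scaled_pullback (s : R) (f : M -> M) (g h : tensor2) : Prop :=
  forall c d p, atlas c -> atlas d -> cdom c p -> cdom d (f p) ->
    let J := 'J (local_expr c d f) (c p) in
    h c (c p) = s *: (J *m g d (d (f p)) *m J^T).

Definition koszul_soliton (T : \bar R) (g : R -> tensor2) : Prop :=
  hesse_koszul_flow T g /\
  exists (phi : R -> M -> M) (sigma : R -> R),
    [/\ smooth_family (@atlas R n M) (time T) phi /\ phi 0 = id,
        smooth_within (time T) sigma /\ sigma 0 = 1,
        forall t, time T t -> bijective (phi t) /\ affine_map (phi t) &
        forall t, time T t -> is_scaled_pullback (sigma t) (phi t) (g 0) (g t)].

End AffineGeometry.

(** * The tangent bundle *)

(* A tangent vector at tbase is a family of components, one row for each chart
   around tbase, that transforms by the Jacobian matrices of the transition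
   maps. *)
Record tangent (R : realType) (n : nat) (M : smooth_manifold R n) := Tangent {
  tbase : M;
  tcomp : chart R M n -> 'rV[R]_n;
  tcomp_change : forall c d, atlas c -> atlas d -> cdom c tbase -> cdom d tbase ->
    tcomp d = tcomp c *m 'J (transition c d) (c tbase);
  tcomp_out : forall c, ~ (atlas c /\ cdom c tbase) -> tcomp c = 0 }.

Section TangentBundle.
Context {R : realType} {n : nat} (M : smooth_manifold R n).

Lemma tangent0_change (p : M) (c d : chart R M n) :
  atlas c -> atlas d -> cdom c p -> cdom d p ->
  0 = (0 : 'rV[R]_n) *m 'J (transition c d) (c p).
Proof. by rewrite mul0mx. Qed.

Definition tangent0 (p : M) : tangent M :=
  Tangent (@tangent0_change p) (fun=> fun=> erefl).

HB.instance Definition _ := gen_eqMixin (tangent M).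
HB.instance Definition _ := gen_choiceMixin (tangent M).

(* (x^1 o pi, ..., x^n o pi, dx^1, ..., dx^n) *)
Definition tcoord (c : chart R M n) (X : tangent M) : 'rV[R]_(n + n) :=
  row_mx (c (tbase X)) (tcomp X c).

Definition tangent_open (U : set (tangent M)) : Prop :=
  forall c X, atlas c -> cdom c (tbase X) -> U X ->
    \forall y \near tcoord c X,
      forall Y, cdom c (tbase Y) -> tcoord c Y = y -> U Y.

Lemma tangent_openT : tangent_open setT.
Proof. by move=> c X _ _ _; apply: filterE. Qed.

Lemma tangent_openI U V : tangent_open U -> tangent_open V -> tangent_open (U `&` V).
Proof.
move=> oU oV c X Ac cX [UX VX].
have := oU c X Ac cX UX; have := oV c X Ac cX VX.
by apply: filterS2 => y hV hU Y cY eY; split; [exact: hU|exact: hV].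
Qed.

Lemma tangent_open_bigU (I : Type) (F : I -> set (tangent M)) :
  (forall i, tangent_open (F i)) -> tangent_open (\bigcup_i F i).
Proof.
move=> oF c X Ac cX [i _ FX]; have := oF i c X Ac cX FX.
by apply: filterS => y h Y cY eY; exists i => //; exact: h.
Qed.

HB.instance Definition _ :=
  isOpenTopological.Build (tangent M) tangent_openT tangent_openI tangent_open_bigU.

(* On the image of tcoord c, the inverse is the (unique) tangent vector over
   cdom c with the given coordinates. *)
Definition tangent_chart (c : chart R M n) : chart R (tangent M) (n + n) :=
  Chart (fun X => cdom c (tbase X)) (tcoord c)
    (fun y => xget (tangent0 (cinv c (lsubmx y)))
                [set X | cdom c (tbase X) /\ tcoord c X = y]).

End TangentBundle.

(** * Complex manifolds *)

Section ComplexGeometry.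
Context {R : realType} {n : nat} {X : topologicalType} {I : Type}.

(* A complex structure on X is given by an indexed, not necessarily maximal,
   holomorphic atlas z. *)
Variable z : I -> chart R X (n + n).

Definition complex_manifold : Prop :=
  [/\ hausdorff_space X /\ @second_countable X,
      forall i, is_chart (z i),
      forall p, exists i, cdom (z i) p &
      forall i j, holomorphic_on (z i @` (cdom (z i) `&` cdom (z j)))
                                 (transition (z i) (z j))].

Definition holomorphic_map (f : X -> X) : Prop :=
  forall p i j, cdom (z i) p -> cdom (z j) (f p) ->
  exists U : set 'rV[R]_(n + n),
    [/\ open U, U (z i p), U `<=` cimg (z i),
        forall w, U w -> cdom (z j) (f (cinv (z i) w)) &
        holomorphic_on U (local_expr (z i) (z j) f)].

Definition biholomorphism (f : X -> X) : Prop :=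
  exists f' : X -> X,
    [/\ cancel f f', cancel f' f, holomorphic_map f & holomorphic_map f'].

(* Components h_(a \bar b), as functions of the coordinates, in each chart of
   the atlas. *)
Definition tensor11 := I -> 'rV[R]_(n + n) -> 'M[R[i]]_n.

Definition hermitian_metric (h : tensor11) : Prop :=
  [/\ forall i a b, smooth_on (cimg (z i)) (fun w => complex.Re (h i w a b)) /\
                    smooth_on (cimg (z i)) (fun w => complex.Im (h i w a b)),
      forall i w, cimg (z i) w -> adjmx (h i w) = h i w,
      forall i w, cimg (z i) w -> forall v : 'rV[R[i]]_n, v != 0 ->
        0 < (v *m h i w *m adjmx v) 0 0 &
      forall i j p, cdom (z i) p -> cdom (z j) p ->
        let J := jacobianC (transition (z i) (z j)) (z i p) in
        h i (z i p) = J *m h j (z j p) *m adjmx J].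

(* The second condition is the closedness of the (1, 1)-form
   \sum_(a, b) sqrt(-1) h_(a \bar b) dz^a /\ d\bar z^b; the (1, 2)-part of its
   differential is conjugate to the (2, 1)-part since h is Hermitian. *)
Definition kahler_metric (h : tensor11) : Prop :=
  hermitian_metric h /\
  forall i w, cimg (z i) w -> forall k a b,
    dz k (fun y => h i y a b) w = dz a (fun y => h i y k b) w.

(* \det of a Hermitian matrix is real. *)
Definition ricci (h : tensor11) (i : I) (w : 'rV[R]_(n + n)) (a b : 'I_n) : R[i] :=
  - dz a (dzbar b (fun y => (ln (complex.Re (\det (h i y))))%:C)) w.

Definition kahler_ricci_flow (T : \bar R) (h : R -> tensor11) : Prop :=
  (forall t, time T t -> kahler_metric (h t)) /\
  forall t i w a b, time T t -> cimg (z i) w ->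
    is_derivC_within (time T) (fun s => h s i w a b) t (- ricci (h t) i w a b).

(* h = s f^* g for holomorphic f *)
Definition is_scaled_pullbackC (s : R) (f : X -> X) (g h : tensor11) : Prop :=
  forall i j p, cdom (z i) p -> cdom (z j) (f p) ->
    let J := jacobianC (local_expr (z i) (z j) f) (z i p) in
    h i (z i p) = s%:C *: (J *m g j (z j (f p)) *m adjmx J).

Definition kahler_ricci_soliton (T : \bar R) (h : R -> tensor11) : Prop :=
  kahler_ricci_flow T h /\
  exists (psi : R -> X -> X) (sigma : R -> R),
    [/\ smooth_family (range z) (time T) psi /\ psi 0 = id,
        smooth_within (time T) sigma /\ sigma 0 = 1,
        forall t, time T t -> biholomorphism (psi t) &
        forall t, time T t -> is_scaled_pullbackC (sigma t) (psi t) (h 0) (h t)].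

End ComplexGeometry.

(** * The complex structure J_nabla and the metric g^T on TM *)

Section TangentComplex.
Context {R : realType} {n : nat} (M : affine_manifold R n).

Definition affine_coordinates := {c : chart R M n | affine_chart c}.

(* The charts z^j = x^j o pi + i dx^j, for affine coordinates x, which define
   the complex structure J_nabla. *)
Definition TM_chart (c : affine_coordinates) : chart R (tangent M) (n + n) :=
  tangent_chart (sval c).

(* g^T = \sum_(i, j) (g_ij o pi) dz^i d\bar z^j *)
Definition gT (g : tensor2 M) : tensor11 (R := R) (n := n) (I := affine_coordinates) :=
  fun c w => map_mx (fun a : R => a%:C) (g (sval c) (lsubmx w)).

End TangentComplex.

(* Main.v *)
(* A Hessian metric is locally the Hessian of a function in affine coordinates, so
   affine charts cover M.  Transition maps between affine charts have vanishing
   second derivatives by the change-of-chart formula for the Christoffel symbols,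
   hence are locally x |-> x A + b.  Every affine map f has the same form in affine
   charts, and its tangent map is then (x, y) |-> (x A + b, y A), that is
   z |-> z A + b, which is holomorphic with complex Jacobian A.  So the tangent maps
   of the phi_(t/4) give the required biholomorphisms, the transformation rules of
   the g^T are those of the g(t), and for functions of x alone
   d/dz^a d/dzbar^b = (1/4) d^2/dx^a dx^b turns 2 beta into -4 Ric. *)

From HB Require Import structures.
Require Import Defs.
From mathcomp Require Import all_boot all_order all_algebra.
From mathcomp Require Import complex.
From mathcomp Require Import all_classical all_reals all_analysis.
From mathcomp Require Import ring lra.

Set Implicit Arguments.
Unset Strict Implicit.
Unset Printing Implicit Defensive.

Import Order.TTheory GRing.Theory Num.Theory.
Import numFieldNormedType.Exports.

(** * Smooth functions and the symmetry of second derivatives *)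

Section SmoothCalculus.
Context {R : realType}.
Local Open Scope classical_set_scope.
Local Open Scope ring_scope.

(** Overlaps of affine charts may be disconnected, so a transition map or an affine map need not
    have a single pair [A], [b]; statements about them are made for germs at a point.

    The definition of an affine map leaves [A] free to be singular. For a soliton, invertibility
    comes from the metric: a vector [v] with [v A = 0] would have length zero for [g t]. Hence the
    inverses of the [phi t] are affine as well, and their tangent maps invert those of the [phi t].

    Closedness of the Kähler form is the symmetry of the third derivatives of a local potential. As
    smoothness is phrased with iterated directional derivatives, the exchange of two of them is
    proved through second differences.

    Smoothness of the tangent maps in time is delicate at the end point 0, where [phi] is only the
    restriction of a smooth extension; the tangent maps use spatial derivatives alone, taken inside
    time slices on which the extension agrees with [phi]. *)

Lemma near_eq_differentiable (V W : normedModType R) (f g : V -> W) (x : V) :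
  (\forall y \near x, f y = g y) -> differentiable f x -> differentiable g x.
Proof.
move=> fg df.
have E : g \o shift x = cst (g x) + 'd f x +o_ 0 id.
  have fgx := nbhs_singleton fg.
  have fg0 : \forall h \near (0 : V), f (h + x) = g (h + x).
    by move: fg; rewrite (near_shift 0 x) subr0.
  have := diff_locally df => /eqaddoP fo.
  apply/eqaddoP => e e0; apply: filterS2 fg0 (fo e e0) => h fgh.
  rewrite -![(_ + _ : _ -> _) _]/(_ + _).
  by rewrite -![(- _ : _ -> _) _]/(- _) /= fgh fgx.
have dg : 'd g x = 'd f x :> (V -> W) by apply: diff_unique => //; exact: diff_continuous.
by apply/diff_locallyP; rewrite dg; split => //; exact: diff_continuous.
Qed.

Lemma differentiable_lin (V W : normedModType R) (L : V -> W) (x : V) :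
  linear L -> continuous L -> differentiable L x.
Proof.
move=> linL cL.
pose m := GRing.isLinear.Build _ _ _ _ L linL.
pose l : {linear V -> W} := HB.pack L m.
exact: (@linear_differentiable _ _ _ l).
Qed.

Lemma linear_fun0 (V W : lmodType R) (L : V -> W) : linear L -> L 0 = 0.
Proof. by move=> /(_ (-1) 0 0); rewrite scaler0 addr0 scaleN1r addNr. Qed.

Lemma linear_funB (V W : lmodType R) (L : V -> W) x y :
  linear L -> L (x - y) = L x - L y.
Proof. by move=> linL; rewrite addrC -scaleN1r linL scaleN1r addrC. Qed.

Lemma linear_funZ (V W : lmodType R) (L : V -> W) a x :
  linear L -> L (a *: x) = a *: L x.
Proof. by move=> linL; rewrite -[a *: x]addr0 linL (linear_fun0 linL) addr0. Qed.

(** By linearity of [L] both sides are limits of the same difference quotient, so they agree even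
    where the limit takes its default value. *)
Lemma derive_comp_lin (V' V W : normedModType R) (L : V' -> V) (f : V -> W) v x :
  linear L -> 'D_v (f \o L) x = 'D_(L v) f (L x).
Proof.
move=> linL; rewrite /derive.
set g1 := fun h => _; set g2 := fun h => _; suff -> : g1 = g2 by [].
by apply/funext => h; rewrite /g1 /g2 /= linL.
Qed.

Lemma is_derive_lin_comp (V W W' : normedModType R) (L : W -> W') (f : V -> W) x v :
  linear L -> continuous L -> derivable f x v ->
  is_derive x v (L \o f) (L ('D_v f x)).
Proof.
move=> linL cL df.
have E : (fun h => h^-1 *: (((L \o f) \o shift x) (h *: v) - (L \o f) x)) @ 0^' -->
    L ('D_v f x).
  rewrite (_ : (fun _ => _) =
     L \o (fun h => h^-1 *: ((f \o shift x) (h *: v) - f x))).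
    by apply: cvg_comp; [exact: df|exact: cL].
  by apply/funext => h; rewrite /= (linear_funZ _ _ linL) (linear_funB _ _ linL).
by apply: DeriveDef; [apply/cvg_ex; eexists; exact: E|exact: cvg_lim E].
Qed.

Lemma is_derive_lin (V W : normedModType R) (L : V -> W) x v :
  linear L -> is_derive x v L (L v).
Proof.
move=> linL.
have E : \forall h \near 0^', L v = h^-1 *: ((L \o shift x) (h *: v) - L x).
  near=> h; rewrite /= linL addrK scalerA mulVf ?scale1r//.
  by near: h; exact: nbhs_dnbhs_neq.
have E' : (fun h => h^-1 *: ((L \o shift x) (h *: v) - L x)) @ 0^' --> L v.
  by apply: cvg_near_cst; apply: filterS E => h ->.
by apply: DeriveDef; [apply/cvg_ex; eexists; exact: E'|exact: cvg_lim E'].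
Unshelve. all: by end_near. Qed.

Lemma smooth_on_differentiable (V W : normedModType R) (U : set V) (f : V -> W) x :
  smooth_on U f -> U x -> differentiable f x.
Proof. by move=> sf Ux; exact: (sf [::] x Ux). Qed.

Lemma smooth_on_sub (V W : normedModType R) (U U' : set V) (f : V -> W) :
  U' `<=` U -> smooth_on U f -> smooth_on U' f.
Proof. by move=> sU sf s x U'x; apply: sf; exact: sU. Qed.

Lemma iter_derive_rcons (V W : normedModType R) (f : V -> W) s v :
  iter_derive (rcons s v) f = iter_derive s (fun x => 'D_v f x).
Proof. by rewrite /iter_derive foldr_rcons. Qed.

Lemma smooth_on_derive (V W : normedModType R) (U : set V) (f : V -> W) v :
  smooth_on U f -> smooth_on U (fun x => 'D_v f x).
Proof. by move=> sf s x Ux; rewrite -iter_derive_rcons; exact: sf. Qed.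

Lemma iter_derive_eq_on (V W : normedModType R) (U : set V) (f g : V -> W) s :
  open U -> (forall x, U x -> f x = g x) ->
  forall x, U x -> iter_derive s f x = iter_derive s g x.
Proof.
move=> oU fg; elim: s => [|v s IHs] x Ux /=; first exact: fg.
by apply: near_eq_derive; apply: filterS (open_nbhs_nbhs (conj oU Ux)).
Qed.

Lemma smooth_on_eq (V W : normedModType R) (U : set V) (f g : V -> W) :
  open U -> (forall x, U x -> f x = g x) -> smooth_on U f -> smooth_on U g.
Proof.
move=> oU fg sf s x Ux; apply: near_eq_differentiable (sf s x Ux).
apply: filterS (open_nbhs_nbhs (conj oU Ux)); exact: iter_derive_eq_on.
Qed.

Lemma smooth_on_local (V W : normedModType R) (U : set V) (f : V -> W) :
  (forall x, U x -> exists g : V -> W,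
     (\forall y \near x, f y = g y) /\ smooth_on setT g) -> smooth_on U f.
Proof.
move=> H s x Ux; have [g [fg sg]] := H x Ux.
have [B [oB Bx] Bfg] : exists2 B, open_nbhs x B & B `<=` [set y | f y = g y].
  by move: fg; rewrite -nbhs_nearE nbhsE.
apply: (@smooth_on_eq _ _ B g) => //; last exact: smooth_on_sub sg.
by move=> y /Bfg.
Qed.

Lemma smooth_on_lin_comp (V W W' : normedModType R) (U : set V) (L : W -> W')
    (f : V -> W) :
  open U -> linear L -> continuous L -> smooth_on U f -> smooth_on U (L \o f).
Proof.
move=> oU linL cL sf s.
have E : forall x, U x -> L (iter_derive s f x) = iter_derive s (L \o f) x.
  elim: s => [//|v s IHs] x Ux /=.
  rewrite -(near_eq_derive (f := L \o iter_derive s f)).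
    apply/esym/derive_val/is_derive_lin_comp => //.
    exact/diff_derivable/sf.
  by apply: filterS (open_nbhs_nbhs (conj oU Ux)).
move=> x Ux; apply: (@near_eq_differentiable _ _ (L \o iter_derive s f)).
  by apply: filterS (open_nbhs_nbhs (conj oU Ux)).
apply: differentiable_comp; [exact: sf|exact: differentiable_lin].
Qed.

Lemma smooth_on_comp_lin (V' V W : normedModType R) (U : set V) (L : V' -> V)
    (f : V -> W) :
  linear L -> continuous L -> smooth_on U f -> smooth_on (L @^-1` U) (f \o L).
Proof.
move=> linL cL sf s.
have -> : iter_derive s (f \o L) = iter_derive (map L s) f \o L.
  elim: s => [//|v s /= ->]; apply/funext => x; exact: derive_comp_lin.
move=> x Ux; apply: differentiable_comp; [exact: differentiable_lin|exact: sf].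
Qed.

Lemma smooth_on_cst (V W : normedModType R) (U : set V) (c : W) :
  smooth_on U (fun _ : V => c).
Proof.
move=> s x _.
have [d ->] : exists d, iter_derive s (fun _ : V => c) = cst d.
  elim: s => [|v s [d E]] /=; first by exists c.
  by exists 0; apply/funext => y; rewrite E derive_cst.
exact: differentiable_cst.
Qed.

Lemma smooth_on_lin (V W : normedModType R) (U : set V) (L : V -> W) :
  linear L -> continuous L -> smooth_on U L.
Proof.
move=> linL cL s x Ux; case/lastP: s => [|s v]; first exact: differentiable_lin.
rewrite iter_derive_rcons.
have -> : (fun y => 'D_v L y) = cst (L v).
  by apply/funext => y; exact/derive_val/is_derive_lin.
exact: (smooth_on_cst (L v) (U := U)).
Qed.

(** Only derivatives of order below [size s] are assumed differentiable: this is what the induction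
    in [smooth_onM] has at hand. *)
Lemma iter_deriveD (V W : normedModType R) (U : set V) (f g : V -> W) s :
  open U ->
  (forall s', (size s' < size s)%N -> forall x, U x ->
    differentiable (iter_derive s' f) x /\ differentiable (iter_derive s' g) x) ->
  forall x, U x -> iter_derive s (f \+ g) x = iter_derive s f x + iter_derive s g x.
Proof.
move=> oU; elim: s => [//|v s IHs] dfg x Ux /=.
rewrite -(near_eq_derive (f := iter_derive s f + iter_derive s g)).
  by have [df dg] := dfg s (ltnSn _) x Ux; rewrite deriveD//; exact: diff_derivable.
apply: filterS (open_nbhs_nbhs (conj oU Ux)) => y Uy; rewrite IHs// => s' s's.
by apply: dfg; rewrite ltnS ltnW.
Qed.

Lemma smooth_onD (V W : normedModType R) (U : set V) (f g : V -> W) :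
  open U -> smooth_on U f -> smooth_on U g -> smooth_on U (f \+ g).
Proof.
move=> oU sf sg s x Ux.
apply: (@near_eq_differentiable _ _ (iter_derive s f + iter_derive s g)).
  apply: filterS (open_nbhs_nbhs (conj oU Ux)) => y Uy.
  by rewrite (iter_deriveD oU)// => s' _ z Uz; split; [exact: sf|exact: sg].
by apply: differentiableD; [exact: sf|exact: sg].
Qed.

Lemma smooth_on_sum (V W : normedModType R) (U : set V) (I : finType)
    (f : I -> V -> W) :
  open U -> (forall i, smooth_on U (f i)) -> smooth_on U (fun x => \sum_i f i x).
Proof.
move=> oU sf; rewrite -[X in smooth_on U X]/(fun x => _).
elim: (index_enum I) => [|i r IHr].
  rewrite (_ : (fun _ => _) = fun=> 0); first exact: smooth_on_cst.
  by apply/funext => x; rewrite big_nil.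
rewrite (_ : (fun _ => _) = f i \+ (fun x => \sum_(j <- r) f j x)).
  exact: smooth_onD.
by apply/funext => x; rewrite big_cons.
Qed.

(** Strong induction on the number of derivatives. The innermost one gives [f D_v g + g D_v f], a
    sum of products of smooth functions that is differentiated one time less. *)
Lemma smooth_onM (V : normedModType R) (U : set V) (f g : V -> R) :
  open U -> smooth_on U f -> smooth_on U g -> smooth_on U (f \* g).
Proof.
move=> oU + + s; have [k sk] := ubnP (size s).
elim: k s f g sk => // k IHk s f g + sf sg x Ux.
case/lastP: s => [_|s v]; first by apply: differentiableM; [exact: (sf [::])|exact: (sg [::])].
rewrite size_rcons ltnS => sk; rewrite iter_derive_rcons.
pose h1 := f \* (fun y => 'D_v g y); pose h2 := g \* (fun y => 'D_v f y).
have dh s' : (size s' < k)%N -> forall y, U y ->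
    differentiable (iter_derive s' h1) y /\ differentiable (iter_derive s' h2) y.
  by move=> s'k y Uy; split; apply: IHk => //; exact: smooth_on_derive.
apply: (@near_eq_differentiable _ _ (iter_derive s h1 + iter_derive s h2)).
  apply: filterS (open_nbhs_nbhs (conj oU Ux)) => y Uy.
  transitivity (iter_derive s (h1 \+ h2) y).
    by rewrite (iter_deriveD oU)// => s' s's; apply: dh; exact: ltn_trans sk.
  apply: (iter_derive_eq_on _ oU) Uy => z Uz.
  by rewrite [RHS]deriveM//; apply: diff_derivable; [exact: (sf [::])|exact: (sg [::])].
by have [] := dh s sk x Ux; exact: differentiableD.
Qed.

(** * Mean values, second derivatives and Jacobian matrices *)

Lemma row_sum_partial n (W : normedModType R) (f : 'rV[R]_n -> W) x v :
  differentiable f x -> 'D_v f x = \sum_j v 0 j *: 'D_(delta_mx 0 j) f x.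
Proof.
move=> df; rewrite deriveE// {1}(row_sum_delta v) linear_sum /=.
by apply: eq_bigr => j _; rewrite linearZ deriveE.
Qed.

Lemma linear_rV_sum n (W : lmodType R) (L : 'rV[R]_n -> W) v :
  linear L -> L v = \sum_j v 0 j *: L (delta_mx 0 j).
Proof.
move=> linL; pose m := GRing.isLinear.Build _ _ _ _ L linL.
pose l : {linear 'rV[R]_n -> W} := HB.pack L m.
rewrite -[LHS]/(l v) {1}(row_sum_delta v) linear_sum.
by apply: eq_bigr => j _; rewrite linearZ.
Qed.

Lemma linear_continuous_rV n (W : normedModType R) (L : 'rV[R]_n -> W) :
  linear L -> continuous L.
Proof.
move=> linL.
have -> : L = \sum_(j < n) (fun z : 'rV[R]_n => z 0 j *: L (delta_mx 0 j)).
  by apply/funext => z; rewrite fct_sumE; exact: linear_rV_sum.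
move=> z; apply/differentiable_continuous/differentiable_sum => j.
exact/differentiableZl/differentiable_coord.
Qed.

Lemma derive_segment (V : normedModType R) (f : V -> R) (x v : V) :
  (forall t : R, 0 <= t <= 1 -> derivable f (x + t *: v) v) ->
  exists2 c : R, 0 <= c <= 1 & f (x + v) - f x = 'D_v f (x + c *: v).
Proof.
move=> df; pose k t := f (x + t *: v).
have E (t : R) : (fun h : R => h^-1 *: ((k \o shift t) (h *: (1 : R)) - k t)) =
    (fun h => h^-1 *: ((f \o shift (x + t *: v)) (h *: v) - f (x + t *: v))).
  apply/funext => h; rewrite /k /= [h%:A]mulr1 scalerDl.
  by rewrite [x + _]addrC -addrA [_ + x]addrC.
have dk (t : R) : 0 <= t <= 1 -> is_derive t (1 : R) k ('D_v f (x + t *: v)).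
  by move=> t01; apply: DeriveDef; rewrite /derivable/derive E//; exact: df.
have [||c c01] := @MVT_segment R k (fun t => 'D_v f (x + t *: v)) 0 1 ler01.
- by move=> t; rewrite in_itv /= => /andP[/ltW t0 /ltW t1]; apply: dk; rewrite t0.
- apply: derivable_within_continuous => t; rewrite in_itv /= => t01.
  by have [] := dk t t01.
rewrite /k scale1r scale0r addr0 subr0 mulr1 => ->.
by exists c => //; move: c01; rewrite in_itv.
Qed.

Lemma constant_on_ball n (f : 'rV[R]_n -> R) x r :
  (forall y, ball x r y -> differentiable f y) ->
  (forall y, ball x r y -> forall i, partial i f y = 0) ->
  forall y, ball x r y -> f y = f x.
Proof.
move=> df pf y xy.
(* Balls are convex, so the mean value theorem applies on the segment from [x] to [y]. *)
have seg (t : R) : 0 <= t <= 1 -> ball x r (x + t *: (y - x)).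
  move=> /andP[t0 t1]; rewrite -ball_normE /= opprD addNKr normrN normrZ ger0_norm//.
  move: xy; rewrite -ball_normE /= distrC; apply: le_lt_trans.
  by rewrite ler_piMl.
have [t t01|c c01] := @derive_segment _ f x (y - x).
  by apply/diff_derivable/df/seg.
rewrite [x + (y - x)]addrC subrK row_sum_partial; last by apply/df/seg.
rewrite big1 => [/eqP|j _]; first by rewrite subr_eq0 => /eqP.
by rewrite [X in _ *: X](pf _ (seg _ c01)) scaler0.
Qed.

Lemma jacobianE n m (f : 'rV[R]_n -> 'rV[R]_m) x i j :
  differentiable f x -> 'J f x i j = partial i (fun y => f y 0 j) x.
Proof.
move=> df; have dfx v : derivable f x v by exact: diff_derivable.
have -> : 'J f x i j = row i ('J f x) 0 j by rewrite [RHS]mxE.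
by rewrite rowE -deriveEjacobian// derive_mx// mxE.
Qed.

Lemma coord_linear m n i j : linear (fun A : 'M[R]_(m, n) => A i j : R).
Proof. by move=> a A B; rewrite !mxE. Qed.

Lemma smooth_on_coord (V : normedModType R) m n (U : set V) (f : V -> 'M[R]_(m, n)) i j :
  open U -> smooth_on U f -> smooth_on U (fun x => f x i j).
Proof.
move=> oU sf; apply: (@smooth_on_lin_comp _ _ _ _ (fun A : 'M[R]_(m, n) => A i j : R) f) => //.
  exact: coord_linear.
exact: coord_continuous.
Qed.

(** On a ball around [x] the first partials of each component are constant, since their own partials
    vanish. Subtracting the linear form [L] with these constants as coefficients leaves a function
    with zero partials, hence a constant. *)
Lemma smooth_locally_affine n m (U : set 'rV[R]_n) (f : 'rV[R]_n -> 'rV[R]_m) x :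
  open U -> smooth_on U f ->
  (forall y, U y -> forall i j a, partial i (partial j (fun z => f z 0 a)) y = 0) ->
  U x -> \forall y \near x, f y = y *m 'J f x + (f x - x *m 'J f x).
Proof.
move=> oU sf ppf Ux.
have /nbhs_ballP[r r0 rU] := open_nbhs_nbhs (conj oU Ux).
near=> y; have xy : ball x r y by near: y; exact: nbhsx_ballx.
have df z : ball x r z -> differentiable f z by move=> /rU Uz; exact: (sf [::]).
apply/rowP => a; rewrite addrCA -mulmxBl !mxE; apply/eqP.
rewrite -subr_eq0; apply/eqP.
pose c j := partial j (fun z => f z 0 a) x.
pose L z := \sum_j (z : 'rV[R]_n) 0 j * c j.
have linL : linear L.
  move=> k u v; rewrite /L scaler_sumr -big_split; apply: eq_bigr => j _ /=.
  by rewrite !mxE mulrDl [k *: _]mulrA.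
have cL : continuous L.
  exact: linear_continuous_rV.
have sfa := smooth_on_coord 0 a oU sf.
have pc z : ball x r z -> forall j, partial j (fun z => f z 0 a) z = c j.
  move=> xz j; apply: constant_on_ball xz => w /rU Uw.
    exact: (smooth_on_derive _ sfa [::]).
  by move=> i; exact: ppf.
have dL z : differentiable L z by exact: differentiable_lin.
have dfa z : ball x r z -> differentiable (fun w => f w 0 a) z.
  by move=> /rU Uz; exact: (sfa [::]).
have := @constant_on_ball _ ((fun z => f z 0 a) - L) x r _ _ y xy.
rewrite -![(_ - _ : _ -> _) _]/(_ - _) => kc.
have {kc} : f y 0 a - L y = f x 0 a - L x.
  apply: kc => z xz; first by apply: differentiableB => //; exact: dfa.
  move=> i; rewrite /partial deriveB; [|exact/diff_derivable/dfa|exact/diff_derivable/dL].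
  rewrite [X in X - _]pc// (derive_val (is_derive := is_derive_lin z _ linL)).
  rewrite /L (bigD1 i)//= mxE !eqxx mul1r big1 ?addr0 ?subrr// => j ji.
  by rewrite mxE (negbTE ji) andbF mul0r.
have -> : \sum_j (y - x) 0 j * 'J f x j a = L (y - x).
  apply: eq_bigr => j _; rewrite jacobianE//; apply: df; exact: ballxx.
by rewrite (linear_funB _ _ linL) => E; lra.
Unshelve. all: by end_near. Qed.

Lemma is_derive_shiftV (V W : normedModType R) (f : V -> W) (w x v : V) :
  derivable f (x + w) v -> is_derive x v (fun y => f (y + w)) ('D_v f (x + w)).
Proof.
have E : (fun h : R => h^-1 *: (((fun y => f (y + w)) \o shift x) (h *: v) - f (x + w))) =
    (fun h : R => h^-1 *: ((f \o shift (x + w)) (h *: v) - f (x + w))).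
  by apply/funext => h /=; rewrite addrA.
by move=> df; apply: DeriveDef; rewrite /derivable /derive E.
Qed.

Lemma derive_scale_dir (V W : normedModType R) (f : V -> W) a v x :
  differentiable f x -> 'D_(a *: v) f x = a *: 'D_v f x.
Proof. by move=> df; rewrite !deriveE// linearZ. Qed.

(** The mean value theorem along [v], applied to the increment [k] of [f] along [s u], turns the
    second difference into [s] times a difference of two values of [G = D_v f]; both are then
    expanded to first order at [x]. *)
Lemma second_difference_cvg (V : normedModType R) (U : set V) (f : V -> R) x u v :
  open U -> smooth_on U f -> U x ->
  (fun s : R => s ^- 2 * (f (x + s *: u + s *: v) - f (x + s *: u)
      - f (x + s *: v) + f x)) @ 0^' --> 'D_u (fun y => 'D_v f y) x.
Proof.
move=> oU sf Ux.
pose G := fun y => 'D_v f y.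
have dG : differentiable G x by exact: (smooth_on_derive v sf [::]).
rewrite -/G deriveE//.
apply/cvgrPdist_le => e e0.
(* The displacements from [x] of the two points compared below have norms at most [|s| |v|] and
   [|s| (|u| + |v|)]; the summand 1 keeps the denominator positive. *)
pose e' := e / (`|v| + `|u| + `|v| + 1).
have e'0 : 0 < e' by rewrite divr_gt0// ltr_wpDl.
have /eqaddoP/(_ e' e'0) := diff_locally dG.
rewrite -nbhs_nearE => /nbhs_ballP[r1 r10 Gr].
have /nbhs_ballP[r2 r20 rU] := open_nbhs_nbhs (conj oU Ux).
pose r := Num.min r1 r2.
have r0 : 0 < r by rewrite lt_min r10 r20.
near=> s.
have s0 : s != 0 by near: s; exact: nbhs_dnbhs_neq.
have sr (a b : R) : 0 <= a <= 1 -> 0 <= b <= 1 -> `|a *: (s *: u) + b *: (s *: v)| < r.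
  move=> /andP[a0 a1] /andP[b0 b1].
  apply: (@le_lt_trans _ _ (`|s| * (`|u| + `|v|))).
    rewrite mulrDr (le_trans (ler_normD _ _))// lerD// normrZ normrZ ger0_norm//.
      by rewrite ler_piMl// mulr_ge0.
    by rewrite ler_piMl// mulr_ge0.
  apply: (@le_lt_trans _ _ (`|s| * (`|u| + `|v| + 1))).
    by rewrite ler_wpM2l// lerDl.
  rewrite -ltr_pdivlMr; last by rewrite ltr_wpDl// addr_ge0.
  by near: s; apply: dnbhs0_lt; rewrite divr_gt0// ltr_wpDl// addr_ge0.
have Gs (a b : R) : 0 <= a <= 1 -> 0 <= b <= 1 ->
   `|G (a *: (s *: u) + b *: (s *: v) + x) - (G x + 'd G x (a *: (s *: u) + b *: (s *: v)))|
     <= e' * `|a *: (s *: u) + b *: (s *: v)|.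
  move=> a1 b1; apply: Gr; rewrite -ball_normE /= sub0r normrN.
  by apply: lt_le_trans (sr _ _ a1 b1) _; rewrite ge_min lexx.
have Us (a b : R) : 0 <= a <= 1 -> 0 <= b <= 1 -> U (x + a *: (s *: u) + b *: (s *: v)).
  move=> a1 b1; apply: rU; rewrite -ball_normE /= -addrA opprD addNKr normrN.
  by apply: lt_le_trans (sr _ _ a1 b1) _; rewrite ge_min lexx orbT.
have u01 : 0 <= (1 : R) <= 1 by rewrite ler01 lexx.
have z01 : 0 <= (0 : R) <= 1 by rewrite ler01 lexx.
pose k y := f (y + s *: u) - f y.
have dk (t : R) : 0 <= t <= 1 -> is_derive (x + t *: (s *: v)) (s *: v) k
    (s * (G (x + 1 *: (s *: u) + t *: (s *: v)) - G (x + 0 *: (s *: u) + t *: (s *: v)))).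
  move=> t01.
  have := sf [::] _ (Us _ _ z01 t01); rewrite -[iter_derive _ _]/f => d0.
  have := sf [::] _ (Us _ _ u01 t01); rewrite -[iter_derive _ _]/f => d1.
  rewrite scale0r addr0 scale1r in d1 d0 *.
  rewrite addrAC in d1 *.
  have D1 := is_derive_shiftV (diff_derivable (v := s *: v) d1).
  have D0 := derivableP (diff_derivable (v := s *: v) d0).
  have D : is_derive (x + t *: (s *: v)) (s *: v) k _ := is_deriveB D1 D0.
  apply: is_derive_eq D _.
  by rewrite !derive_scale_dir// -mulrBr.
have [t t01|t t01] := @derive_segment _ k x (s *: v).
  by have [] := dk t t01.
rewrite (derive_val (is_derive := dk t t01)).
have -> : k (x + s *: v) - k x =
    f (x + s *: u + s *: v) - f (x + s *: u) - f (x + s *: v) + f x.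
  by rewrite /k [x + _ + _]addrAC; ring.
move=> ->.
have := Gs _ _ u01 t01; have := Gs _ _ z01 t01.
rewrite ![_ + x]addrC !addrA scale0r scale1r !addr0 add0r.
set b := t *: _; set G1 := G (x + _ + b); set G0 := G (x + b) => h0 h1.
have bn : `|b| <= `|s| * `|v|.
  case/andP: t01 => t0 t1.
  by rewrite /b !normrZ ger0_norm// ler_piMl// mulr_ge0.
have L1 : 'd G x (s *: u + b) = s * 'd G x u + 'd G x b by rewrite linearD linearZ.
(* The linear parts at the two points differ by exactly [s 'd G x u], so only the two remainders are
   left. *)
have -> : 'd G x u - s ^- 2 * (s * (G1 - G0)) =
    s^-1 * ((G0 - (G x + 'd G x b)) - (G1 - (G x + 'd G x (s *: u + b)))).
  by rewrite L1; field.
rewrite normrM normfV ler_pdivrMl ?normr_gt0//.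
apply: le_trans (ler_normB _ _) _; apply: le_trans (lerD h0 h1) _.
apply: (@le_trans _ _ (e' * (`|s| * (`|v| + `|u| + `|v|)))).
  rewrite -mulrDr ler_wpM2l ?(ltW e'0)// mulrDr mulrDr -addrA lerD//.
  apply: le_trans (ler_normD _ _) _; rewrite lerD// normrZ//.
rewrite mulrCA ler_wpM2l// /e' mulrAC ler_pdivrMr ?ltr_wpDl//.
by rewrite ler_pM2l// lerDl.
Unshelve. all: by end_near. Qed.

(* The second difference is symmetric in [u] and [v]. *)
Lemma derive_comm (V : normedModType R) (U : set V) (f : V -> R) x u v :
  open U -> smooth_on U f -> U x ->
  'D_u (fun y => 'D_v f y) x = 'D_v (fun y => 'D_u f y) x.
Proof.
move=> oU sf Ux.
have vu := second_difference_cvg (u := v) (v := u) oU sf Ux.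
have uv := second_difference_cvg (u := u) (v := v) oU sf Ux.
suff E : (fun s : R => s ^- 2 * (f (x + s *: v + s *: u) - f (x + s *: v)
      - f (x + s *: u) + f x)) = (fun s : R => s ^- 2 *
    (f (x + s *: u + s *: v) - f (x + s *: u) - f (x + s *: v) + f x)).
  by rewrite E in vu; apply: (cvg_unique _ uv vu); exact: norm_hausdorff.
by apply/funext => s; rewrite [x + _ + _]addrAC; congr (_ * _); ring.
Qed.

Lemma jacobian_rowP n m (A B : 'M[R]_(n, m)) : (forall v : 'rV[R]_n, v *m A = v *m B) -> A = B.
Proof. by move=> AB; apply/row_matrixP => i; rewrite !rowE. Qed.

Lemma near_eq_jacobian n m (f g : 'rV[R]_n -> 'rV[R]_m) x :
  (\forall y \near x, f y = g y) -> differentiable f x -> 'J f x = 'J g x.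
Proof.
move=> fg df; have dg := near_eq_differentiable fg df.
apply: jacobian_rowP => v.
have /= fv := deriveEjacobian v df; have /= gv := deriveEjacobian v dg.
by move: (near_eq_derive v fg); rewrite fv gv.
Qed.

Lemma jacobian_comp n m k (f : 'rV[R]_n -> 'rV[R]_m) (g : 'rV[R]_m -> 'rV[R]_k) x :
  differentiable f x -> differentiable g (f x) ->
  'J (g \o f) x = 'J f x *m 'J g (f x).
Proof.
move=> df dg; apply: jacobian_rowP => v.
by rewrite mulmxA /jacobian !mul_rV_lin1 /= diff_comp.
Qed.

Lemma mulmxr_linear n m (A : 'M[R]_(n, m)) : linear (fun x : 'rV[R]_n => x *m A).
Proof. by move=> a u v; rewrite mulmxDl scalemxAl. Qed.

Lemma mulmxr_continuous n m (A : 'M[R]_(n, m)) :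
  continuous (fun x : 'rV[R]_n => x *m A : 'rV[R]_m).
Proof. exact/linear_continuous_rV/mulmxr_linear. Qed.

Lemma smooth_on_affine n m (U : set 'rV[R]_n) (A : 'M[R]_(n, m)) b :
  smooth_on U (fun x : 'rV[R]_n => x *m A + b : 'rV[R]_m).
Proof.
apply: (@smooth_on_sub _ _ setT) => //.
apply: (@smooth_onD _ _ _ (fun x => x *m A) (fun=> b)).
- exact: openT.
- by apply: smooth_on_lin; [exact: mulmxr_linear|exact: mulmxr_continuous].
- exact: smooth_on_cst.
Qed.

Lemma near_affine_jacobian n m (f : 'rV[R]_n -> 'rV[R]_m) x A b :
  (\forall y \near x, f y = y *m A + b) -> differentiable f x /\ 'J f x = A.
Proof.
move=> fA.
have dA : differentiable (fun x : 'rV[R]_n => x *m A + b) x.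
  exact: (smooth_on_affine (U := setT) A b [::]).
have fA' : \forall y \near x, y *m A + b = f y by apply: filterS fA.
have df := near_eq_differentiable fA' dA; split => //.
rewrite -(near_eq_jacobian fA' dA); apply: jacobian_rowP => v.
rewrite -(deriveEjacobian v dA).
have D := is_deriveD (is_derive_lin x v (mulmxr_linear A)) (is_derive_cst b x v).
by rewrite (derive_val (is_derive := D)) addr0.
Qed.

(** The tangent map in coordinates: base point [F (L z)], and the vector [y z] pushed forward along
    the directions [e j]. Separate [L] and [e] serve both transition maps and time-dependent
    families, where [V] is time times space and the [e j] are spatial. *)
Lemma smooth_tangent_lift (V' V : normedModType R) n m (W : set V) (F : V -> 'rV[R]_m)
    (L : V' -> V) (y : V' -> 'rV[R]_n) (e : 'I_n -> V) :
  open W -> smooth_on W F -> linear L -> continuous L -> linear y -> continuous y ->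
  smooth_on (L @^-1` W)
    (fun z => row_mx (F (L z)) (\sum_j y z 0 j *: 'D_(e j) F (L z))).
Proof.
move=> oW sF linL cL liny cy.
have oL : open (L @^-1` W) by apply: open_comp => // x _; exact: cL.
have sD j : smooth_on (L @^-1` W) (fun z => 'D_(e j) F (L z)).
  exact: (smooth_on_comp_lin linL cL (smooth_on_derive (e j) sF)).
have scale_cont k : continuous (fun r : R => r *: delta_mx 0 k : 'rV[R]_m).
  by move=> r; apply: scalel_continuous.
have scale_lin k : linear (fun r : R => r *: delta_mx 0 k : 'rV[R]_m).
  by move=> a u v; rewrite scalerDl scalerA.
have sterm j k : smooth_on (L @^-1` W)
    (fun z => (y z 0 j * 'D_(e j) F (L z) 0 k) *: delta_mx 0 k : 'rV[R]_m).
  apply: (smooth_on_lin_comp oL (scale_lin k) (scale_cont k)).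
  apply: smooth_onM => //; last exact: smooth_on_coord.
  apply: smooth_on_coord => //; exact: smooth_on_lin.
(* The row becomes a sum of linear images of [F (L z)] and of products of scalar functions, to which
   the closure rules for smoothness apply. *)
have -> : (fun z => row_mx (F (L z)) (\sum_j y z 0 j *: 'D_(e j) F (L z))) =
    (fun z => F (L z) *m row_mx 1%:M 0) \+
    (fun z => (\sum_j \sum_k (y z 0 j * 'D_(e j) F (L z) 0 k) *: delta_mx 0 k)
       *m row_mx 0 1%:M).
  apply/funext => z /=; rewrite !mul_mx_row !mulmx0 !mulmx1 add_row_mx addr0 add0r.
  congr row_mx; apply: eq_bigr => j _; rewrite {1}(row_sum_delta ('D_(e j) F (L z))).
  by rewrite scaler_sumr; apply: eq_bigr => k _; rewrite scalerA.
apply: smooth_onD => //.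
  apply: (smooth_on_lin_comp oL (mulmxr_linear _) (@mulmxr_continuous _ _ _)).
  exact: smooth_on_comp_lin.
apply: (smooth_on_lin_comp oL (mulmxr_linear _) (@mulmxr_continuous _ _ _)).
by apply: smooth_on_sum => // j; exact: smooth_on_sum.
Qed.

End SmoothCalculus.

(** * The topology of the tangent bundle *)

Section Charts.
Context {R : realType} {X : topologicalType} {m : nat}.
Local Open Scope classical_set_scope.
Local Open Scope ring_scope.
Implicit Types c d e : chart R X m.

Lemma cinvK c x : is_chart c -> cimg c x -> cdom c (cinv c x) /\ c (cinv c x) = x.
Proof. by move=> [_ _ cK _ _] [q cq <-]; rewrite cK. Qed.

Lemma chart_nbhs c p (A : set X) : is_chart c -> cdom c p -> nbhs p A ->
  \forall x \near c p, cimg c x /\ A (cinv c x).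
Proof.
move=> [oc oi cK cc cic] cp Ap.
have ip : cimg c (c p) by exists p.
near=> x; split; first by near: x; exact: open_nbhs_nbhs.
by near: x; apply: (cic _ ip); rewrite cK.
Unshelve. all: by end_near. Qed.

Lemma cdom_nbhs c p : is_chart c -> cdom c p -> nbhs p (cdom c).
Proof. by move=> [oc _ _ _ _] cp; exact: open_nbhs_nbhs. Qed.

Lemma overlap_open c d : is_chart c -> is_chart d -> open (c @` (cdom c `&` cdom d)).
Proof.
move=> ic id; rewrite openE => _ [p [cp dp] <-].
have := chart_nbhs ic cp (cdom_nbhs id dp).
apply: filterS => x [ix dx]; exists (cinv c x); last by have [] := cinvK ic ix.
by split => //; have [] := cinvK ic ix.
Qed.

End Charts.

(** * Tangent vectors in charts; separation and countability of the tangent bundle *)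

Section Tangent.
Context {R : realType} {n : nat} {M : smooth_manifold R n}.
Local Open Scope classical_set_scope.
Local Open Scope ring_scope.
Implicit Types (c d e : chart R M n) (p : M).
Local Notation atlas := (@atlas R n M).

Lemma transition_differentiable c d p : atlas c -> atlas d -> cdom c p -> cdom d p ->
  differentiable (transition c d) (c p).
Proof.
move=> Ac Ad cp dp; apply: (smooth_on_differentiable (atlas_smooth Ac Ad)).
by exists p.
Qed.

Lemma transitionE c d p : atlas c -> cdom c p -> transition c d (c p) = d p.
Proof. by move=> /atlas_chart[_ _ cK _ _] cp; rewrite /transition /= cK. Qed.

Lemma transition_comp c d e p : atlas c -> atlas d -> cdom c p -> cdom d p ->
  \forall x \near c p, (transition d e \o transition c d) x = transition c e x.
Proof.
move=> Ac Ad cp dp; have id := atlas_chart Ad.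
apply: filterS (chart_nbhs (atlas_chart Ac) cp (cdom_nbhs id dp)) => x [_ dx].
by rewrite /transition /=; case: id => _ _ ->.
Qed.

Lemma jacobian_transition c d e p : atlas c -> atlas d -> atlas e ->
  cdom c p -> cdom d p -> cdom e p ->
  'J (transition c e) (c p) = 'J (transition c d) (c p) *m 'J (transition d e) (d p).
Proof.
move=> Ac Ad Ae cp dp ep.
have dcd := transition_differentiable Ac Ad cp dp.
have dde : differentiable (transition d e) (transition c d (c p)).
  by rewrite transitionE//; exact: transition_differentiable.
have dcde := differentiable_comp dcd dde.
have <- := near_eq_jacobian (transition_comp e Ac Ad cp dp) dcde.
by rewrite (jacobian_comp dcd dde) transitionE.
Qed.

Lemma jacobian_transition_id c p : atlas c -> cdom c p ->
  'J (transition c c) (c p) = 1%:M.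
Proof.
move=> Ac cp; have ic := atlas_chart Ac.
suff : \forall x \near c p, transition c c x = x *m 1%:M + 0.
  by move=> /near_affine_jacobian[].
apply: filterS (chart_nbhs ic cp (cdom_nbhs ic cp)) => x [ix _].
by rewrite mulmx1 addr0; have [] := cinvK ic ix.
Qed.

(** The components in the other charts around [p] are forced by the transition rule; that they obey
    this rule among themselves is the chain rule [jacobian_transition]. *)
Lemma tangent_exists c p (v : 'rV[R]_n) : atlas c -> cdom c p ->
  exists X : tangent M, tbase X = p /\ tcomp X c = v.
Proof.
move=> Ac cp.
pose comp d : 'rV[R]_n :=
  if pselect (atlas d /\ cdom d p) then v *m 'J (transition c d) (c p) else 0.
have compE d : atlas d -> cdom d p -> comp d = v *m 'J (transition c d) (c p).
  by move=> Ad dp; rewrite /comp; case: pselect => // -[].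
have comp_change d e : atlas d -> atlas e -> cdom d p -> cdom e p ->
    comp e = comp d *m 'J (transition d e) (d p).
  move=> Ad Ae dp ep; rewrite (compE e Ae ep) (compE d Ad dp).
  by rewrite (jacobian_transition Ac Ad Ae cp dp ep) mulmxA.
have comp_out d : ~ (atlas d /\ cdom d p) -> comp d = 0.
  by move=> dp; rewrite /comp; case: pselect.
exists (Tangent comp_change comp_out); split => //=.
by rewrite (compE c Ac cp) (jacobian_transition_id Ac cp) mulmx1.
Qed.

Lemma tangent_eq c (X Y : tangent M) : atlas c -> cdom c (tbase X) ->
  tbase X = tbase Y -> tcomp X c = tcomp Y c -> X = Y.
Proof.
case: X Y => [p u cu ou] [q v cv ov] /= Ac cp pq; subst q => uvc.
have uv : u = v.
  apply/funext => d; have [[Ad dp]|nd] := pselect (atlas d /\ cdom d p).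
    by rewrite (cu c d)// (cv c d)// uvc.
  by rewrite ou// ov.
by subst v; congr Tangent; exact: Prop_irrelevance.
Qed.

Lemma tcoord_inj c (X Y : tangent M) : atlas c -> cdom c (tbase X) ->
  cdom c (tbase Y) -> tcoord c X = tcoord c Y -> X = Y.
Proof.
move=> Ac cX cY /eq_row_mx[eb ec]; apply: (tangent_eq Ac cX) => //.
by have [_ _ cK _ _] := atlas_chart Ac; rewrite -(cK _ cX) eb cK.
Qed.

Lemma lsubmx_tcoord c (X : tangent M) : lsubmx (tcoord c X) = c (tbase X).
Proof. exact: row_mxKl. Qed.

Lemma rsubmx_tcoord c (X : tangent M) : rsubmx (tcoord c X) = tcomp X c.
Proof. exact: row_mxKr. Qed.

Lemma tangent_cimgE c y : atlas c -> cimg (tangent_chart c) y <-> cimg c (lsubmx y).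
Proof.
move=> Ac; split=> [[X cX <-]|[p cp py]].
  by exists (tbase X) => //; rewrite /= lsubmx_tcoord.
have [X [Xp Xc]] := tangent_exists (rsubmx y) Ac cp.
by exists X => /=; rewrite ?Xp// /tcoord Xp Xc py hsubmxK.
Qed.

Lemma tangent_cinvK c y : atlas c -> cimg (tangent_chart c) y ->
  let X := cinv (tangent_chart c) y in
  [/\ cdom c (tbase X), tcoord c X = y & tbase X = cinv c (lsubmx y)].
Proof.
move=> Ac [Y cY Yy] X.
have [cX Xy] : cdom c (tbase X) /\ tcoord c X = y.
  by rewrite /X /=; case: xgetP => [Z _ //|/(_ Y)[]].
split => //; rewrite -Xy lsubmx_tcoord.
by have [_ _ cK _ _] := atlas_chart Ac; rewrite cK.
Qed.

Lemma open_tbase (U : set M) : open U -> open [set X : tangent M | U (tbase X)].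
Proof.
move=> oU; have : tangent_open [set X : tangent M | U (tbase X)]; last by [].
move=> c X Ac cX UX.
have ic := atlas_chart Ac.
have H := chart_nbhs ic cX (open_nbhs_nbhs (conj oU UX)).
rewrite -lsubmx_tcoord in H.
have {}H : \forall y \near tcoord c X, cimg c (lsubmx y) /\ U (cinv c (lsubmx y)).
  exact: (@continuous_lsubmx _ _ _ _ (tcoord c X) _ H).
apply: filterS H => y [_ Uy] Y cY Yy /=; move: Uy; rewrite -Yy lsubmx_tcoord.
by case: ic => _ _ ->.
Qed.

Lemma tbase_continuous : continuous (@tbase R n M).
Proof. by apply/continuousP => U; exact: open_tbase. Qed.

(* The product with the Jacobian matrix is expanded into partial derivatives,
   which are visibly smooth. *)
Definition tangent_transition c d (y : 'rV[R]_(n + n)) : 'rV[R]_(n + n) :=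
  row_mx (transition c d (lsubmx y))
    (\sum_j rsubmx y 0 j *: 'D_(delta_mx 0 j) (transition c d) (lsubmx y)).

Lemma tangent_transitionE c d (X : tangent M) : atlas c -> atlas d ->
  cdom c (tbase X) -> cdom d (tbase X) -> tangent_transition c d (tcoord c X) = tcoord d X.
Proof.
move=> Ac Ad cX dX; rewrite /tangent_transition lsubmx_tcoord rsubmx_tcoord transitionE//.
have dt := transition_differentiable Ac Ad cX dX.
congr row_mx; rewrite (tcomp_change Ac Ad cX dX).
by have <- := row_sum_partial (tcomp X c) dt; have -> := deriveEjacobian (tcomp X c) dt.
Qed.

Lemma rsubmx_linear a b : linear (rsubmx : 'M[R]_(1, a + b) -> 'M[R]_(1, b)).
Proof. by move=> k u v; rewrite linearP. Qed.

Lemma lsubmx_linear a b : linear (lsubmx : 'M[R]_(1, a + b) -> 'M[R]_(1, a)).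
Proof. by move=> k u v; rewrite linearP. Qed.

Lemma tangent_transition_continuous c d (X : tangent M) : atlas c -> atlas d ->
  cdom c (tbase X) -> cdom d (tbase X) ->
  {for tcoord c X, continuous (tangent_transition c d)}.
Proof.
move=> Ac Ad cX dX; apply: differentiable_continuous.
have oW := overlap_open (atlas_chart Ac) (atlas_chart Ad).
have := smooth_tangent_lift (fun j => delta_mx 0 j) oW (atlas_smooth Ac Ad)
  (@lsubmx_linear n n) (@continuous_lsubmx _ _ _ _) (@rsubmx_linear n n)
  (@continuous_rsubmx _ _ _ _).
move=> /(_ [::]); apply; rewrite /= lsubmx_tcoord.
by exists (tbase X).
Qed.

(** The topology tests openness in every chart [d], so the coordinates of [c] are reached through
    the continuous transition from [d] to [c]. *)
Lemma open_tcoord c (U : set 'rV[R]_(n + n)) : atlas c -> open U ->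
  open [set X : tangent M | cdom c (tbase X) /\ U (tcoord c X)].
Proof.
move=> Ac oU.
have : tangent_open [set X : tangent M | cdom c (tbase X) /\ U (tcoord c X)]; last by [].
move=> d X Ad dX [cX UX].
have id := atlas_chart Ad; have ic := atlas_chart Ac.
have H := chart_nbhs id dX (cdom_nbhs ic cX).
rewrite -lsubmx_tcoord in H.
have {}H : \forall y \near tcoord d X, cimg d (lsubmx y) /\ cdom c (cinv d (lsubmx y)).
  exact: (@continuous_lsubmx _ _ _ _ (tcoord d X) _ H).
have UTX : nbhs (tangent_transition d c (tcoord d X)) U.
  by apply: open_nbhs_nbhs; split => //; rewrite tangent_transitionE.
have H' : \forall y \near tcoord d X, U (tangent_transition d c y).
  exact: (tangent_transition_continuous Ad Ac dX cX UTX).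
apply: filterS2 H H' => y [_ cy] Uy Y dY Yy /=.
have cY : cdom c (tbase Y).
  by move: cy; rewrite -Yy lsubmx_tcoord; case: id => _ _ ->.
by split => //; have <- := tangent_transitionE Ad Ac dY cY; rewrite Yy.
Qed.

Lemma open_tangent_cimg c : atlas c -> open (cimg (tangent_chart c)).
Proof.
move=> Ac; rewrite (_ : cimg _ = lsubmx @^-1` cimg c).
  apply: open_comp => [y _|]; first exact: continuous_lsubmx.
  by case: (atlas_chart Ac).
by apply/seteqP; split => y /(tangent_cimgE y Ac).
Qed.

Lemma is_chart_tangent c : atlas c -> is_chart (tangent_chart c).
Proof.
move=> Ac; have ic := atlas_chart Ac; split.
- by apply: open_tbase; case: ic.
- exact: open_tangent_cimg.
- move=> X cX; have cXi : cimg (tangent_chart c) (tcoord c X) by exists X.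
  by have [cY YX _] := tangent_cinvK Ac cXi; exact: (tcoord_inj Ac).
- move=> X cX U; rewrite /= nbhsE => -[V [oV VX] VU].
  have := open_nbhs_nbhs (conj (open_tcoord Ac oV) (conj cX VX)).
  by apply: filterS => Y [_ /VU].
- move=> y iy U; rewrite nbhsE => -[V [oV Vy] VU].
  have [cX Xy Xb] := tangent_cinvK Ac iy.
  have oV' : tangent_open V by [].
  have := oV' c _ Ac cX Vy; rewrite Xy.
  apply: filterS2 (open_nbhs_nbhs (conj (open_tangent_cimg Ac) iy)) => z iz Vz.
  have [cZ Zz Zb] := tangent_cinvK Ac iz.
  by apply: VU; exact: Vz.
Qed.

(** Vectors that no neighbourhoods separate have the same base point, [M] being Hausdorff; so they
    lie in one chart, where their coordinates cannot be separated either. *)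
Lemma tangent_hausdorff : hausdorff_space (tangent M).
Proof.
move=> X Y cl.
have XY : tbase X = tbase Y.
  apply: (@sm_hausdorff _ _ M) => A B AX BY.
  have [Z [AZ BZ]] := cl _ _ (tbase_continuous AX) (tbase_continuous BY).
  by exists (tbase Z).
have [c Ac cX] := atlas_cover (tbase X).
have cY : cdom c (tbase Y) by rewrite -XY.
have [_ _ _ cont _] := is_chart_tangent Ac.
apply: (tcoord_inj Ac) => //.
apply: (@norm_hausdorff _ 'rV[R]_(n + n)) => A B AX BY.
have [Z [AZ BZ]] := cl _ _ (cont X cX _ AX) (cont Y cY _ BY).
by exists (tcoord c Z).
Qed.

Lemma rational_ball m (x : 'rV[R]_m) (e : R) : 0 < e ->
  exists (q : 'rV[rat]_m) (k : nat),
    ball (map_mx ratr q : 'rV[R]_m) k.+1%:R^-1 x /\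
    ball (map_mx ratr q : 'rV[R]_m) k.+1%:R^-1 `<=` ball x e.
Proof.
move=> e0; have [|k ke] := @ltr_add_invr R 0 (e / 2); first by rewrite divr_gt0.
rewrite add0r in ke; have k0 : 0 < k.+1%:R^-1 :> R by rewrite invr_gt0.
have /choice[q qx] : forall j, exists r : rat, `|ratr r - x 0 j| < k.+1%:R^-1.
  move=> j; have [|r] := @rat_in_itvoo R (x 0 j - k.+1%:R^-1) (x 0 j + k.+1%:R^-1).
    by rewrite ltrD2l gtrN.
  by rewrite in_itv /= => rx; exists r; rewrite ltr_distl.
have xq : ball (map_mx ratr (\row_j q j) : 'rV[R]_m) k.+1%:R^-1 x.
  by split => // i j; rewrite ord1 !mxE /ball /=; exact: qx.
exists (\row_j q j), k; split => // y qy.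
by rewrite [e]splitr; apply: ball_triangle (le_ball (ltW ke) (ball_sym xq)) (le_ball (ltW ke) qy).
Qed.

(** The atlas may be uncountable, so the chart is chosen as a function [ch B0] of a basic open set.
    A second basic set [B1] localises the base point, since shrinking [B0] itself could change the
    chart; a rational ball localises the fibre component. *)
Lemma tangent_second_countable : @second_countable (tangent M).
Proof.
(* An empty [M] provides no chart to serve as the default value of [ch]. *)
have [[p0 _]|noM] := pselect (exists p : M, True); last first.
  exists set0; first exact: countable0.
  by split => [//|X]; exfalso; apply: noM; exists (tbase X).
have [c0 Ac0 _] := atlas_cover p0.
have [BM cBM [oBM bBM]] := @sm_second_countable _ _ M.
have /choice[ch Hch] : forall B : set M, exists c : chart R M n, atlas c /\
    ((exists2 d, atlas d & B `<=` cdom d) -> B `<=` cdom c).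
  move=> B; have [[c Ac Bc]|nB] := pselect (exists2 d, atlas d & B `<=` cdom d).
    by exists c.
  by exists c0.
pose V (B0 B1 : set M) (qk : 'rV[rat]_n * nat) := [set X : tangent M |
  [/\ B0 (tbase X), B1 (tbase X), cdom (ch B0) (tbase X) &
      ball (map_mx ratr qk.1 : 'rV[R]_n) qk.2.+1%:R^-1 (tcomp X (ch B0))]].
exists (\bigcup_(B0 in BM) \bigcup_(B1 in BM) range (V B0 B1)).
  apply: bigcup_countable => // B0 _; apply: bigcup_countable => // B1 _.
  exact: card_le_trans (card_image_le _ _) (countableP _).
split=> [U [B0 BB0 [B1 BB1 [[q k] _ <-]]]|X U].
  have [Ac _] := Hch B0.
  have oq : open (rsubmx @^-1` ball (map_mx ratr q : 'rV[R]_n) (k.+1%:R^-1 : R) :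
      set 'rV[R]_(n + n)).
    apply: open_comp => [y _|]; first exact: continuous_rsubmx.
    by apply: ball_open; rewrite invr_gt0.
  have := openI (open_tbase (openI (oBM _ BB0) (oBM _ BB1))) (open_tcoord Ac oq).
  congr open; apply/seteqP; split => Y /=; rewrite rsubmx_tcoord.
    by move=> [[? ?] [? ?]].
  by move=> [? ? ? ?].
move=> XU.
have [c Ac cX] := atlas_cover (tbase X).
have [B0 [BB0 B0X] B0c] := bBM _ _ (cdom_nbhs (atlas_chart Ac) cX).
have [Ad /(_ (ex_intro2 _ _ c Ac B0c)) B0d] := Hch B0.
set d := ch B0 in Ad B0d; have dX := B0d _ B0X.
have := chart_nbhs (is_chart_tangent Ad) (dX : cdom (tangent_chart d) X) XU.
rewrite -nbhs_nearE => /nbhs_ballP[e e0 eU].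
have dp : nbhs (tbase X) (d @^-1` ball (d (tbase X)) e).
  by have [_ _ _ cd _] := atlas_chart Ad; apply: (cd _ dX); exact: nbhsx_ballx.
have [B1 [BB1 B1X] B1d] := bBM _ _ dp.
have [q [k [Xq qe]]] := rational_ball (tcomp X d) e0.
exists (V B0 B1 (q, k)).
  split; first by exists B0 => //; exists B1 => //; exists (q, k).
  by split.
move=> Y [/= B0Y B1Y dY Yq].
have [|iY UY] := eU (tcoord d Y).
  split => // i j; rewrite !mxE; case: (splitP j) => l _; rewrite ord1.
    exact: (B1d _ B1Y).2.
  exact: (qe _ Yq).2.
by have [_ _ dK _ _] := is_chart_tangent Ad; move: UY; rewrite (dK Y dY).
Qed.

End Tangent.

(** * Affine maps and their tangent maps *)

Section AffineComplex.
Context {R : realType}.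
Local Open Scope classical_set_scope.
Local Open Scope ring_scope.
Local Open Scope complex_scope.

(* The real form of the complex affine map [z |-> z A + b], with [A] and [b] real. *)
Definition cplx_affine n m (A : 'M[R]_(n, m)) (b : 'rV[R]_m) (y : 'rV[R]_(n + n)) :
    'rV[R]_(m + m) :=
  row_mx (lsubmx y *m A + b) (rsubmx y *m A).

Lemma cplx_affineE n m (A : 'M[R]_(n, m)) b y :
  cplx_affine A b y = y *m block_mx A 0 0 A + row_mx b 0.
Proof.
rewrite /cplx_affine -{3}(hsubmxK y) mul_row_block !mulmx0 addr0 add0r add_row_mx.
by rewrite addr0.
Qed.

Section Derivatives.
Variables (n m : nat) (F : 'rV[R]_(n + n) -> 'rV[R]_(m + m)) (w : 'rV[R]_(n + n)).
Variables (A : 'M[R]_(n, m)) (b : 'rV[R]_m).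
Hypothesis FA : \forall y \near w, F y = cplx_affine A b y.

Lemma cplx_affine_derive (k : 'I_m) (u v : 'rV[R]_n) :
  deriveC (row_mx u v) (fun y => zcoord k (F y)) w = (u *m A) 0 k +i* (v *m A) 0 k.
Proof.
have lin_l : linear (fun y : 'rV[R]_(n + n) => (lsubmx y *m A) 0 k).
  by move=> a x y; rewrite lsubmx_linear mulmxr_linear coord_linear.
have lin_r : linear (fun y : 'rV[R]_(n + n) => (rsubmx y *m A) 0 k).
  by move=> a x y; rewrite rsubmx_linear mulmxr_linear coord_linear.
rewrite /deriveC; congr (_ +i* _).
  transitivity ('D_(row_mx u v) ((fun y => (lsubmx y *m A) 0 k) + cst (b 0 k)) w).
    apply: near_eq_derive; apply: filterS FA => y -> /=.
    by rewrite row_mxKl mxE.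
  have D := is_deriveD (is_derive_lin w (row_mx u v) lin_l) (is_derive_cst (b 0 k) w (row_mx u v)).
  by rewrite (derive_val (is_derive := D)) row_mxKl addr0.
transitivity ('D_(row_mx u v) (fun y => (rsubmx y *m A) 0 k) w).
  by apply: near_eq_derive; apply: filterS FA => y -> /=; rewrite row_mxKr.
by rewrite (derive_val (is_derive := is_derive_lin w (row_mx u v) lin_r)) row_mxKr.
Qed.

Lemma cplx_affine_dx j k : dx j (fun y => zcoord k (F y)) w = (A j k)%:C.
Proof. by rewrite /dx cplx_affine_derive -rowE mul0mx !mxE. Qed.

(** As [A] acts in the same way on base and fibre, the fibre derivative is [i] times the base
    derivative: the Cauchy-Riemann equations. *)
Lemma cplx_affine_dy j k : dy j (fun y => zcoord k (F y)) w = (0 +i* 1) * (A j k)%:C.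
Proof.
rewrite /dy cplx_affine_derive -rowE mul0mx !mxE.
by apply/eqP; rewrite eq_complex /= !mulr0 !mul0r !mul1r subrr add0r !eqxx.
Qed.

Lemma cplx_affine_dzbar j k : dzbar j (fun y => zcoord k (F y)) w = 0.
Proof.
rewrite /dzbar cplx_affine_dx cplx_affine_dy mulrA -expr2 sqr_i mulN1r subrr.
exact: mul0r.
Qed.

Lemma cplx_affine_jacobian : jacobianC F w = map_mx (fun a => a%:C) A.
Proof.
apply/matrixP => j k; rewrite !mxE /dz cplx_affine_dx cplx_affine_dy.
by rewrite mulrA -expr2 sqr_i mulN1r opprK -mulr2n -[_ *+ 2]mulr_natr mulfK// pnatr_eq0.
Qed.

End Derivatives.

Lemma cplx_affine_holomorphic n m (F : 'rV[R]_(n + n) -> 'rV[R]_(m + m)) U :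
  (forall w, U w -> exists A b, \forall y \near w, F y = cplx_affine A b y) ->
  holomorphic_on U F.
Proof.
move=> H; split; last first.
  by move=> w /H[A [b FA]] j k; exact: (cplx_affine_dzbar FA).
apply: smooth_on_local => w /H[A [b FA]]; exists (cplx_affine A b); split => //.
rewrite (_ : cplx_affine A b = fun y => y *m block_mx A 0 0 A + row_mx b 0).
  exact: smooth_on_affine.
by apply/funext => y; exact: cplx_affineE.
Qed.

End AffineComplex.

(** * Affine maps in affine charts and the construction of their tangent maps *)

Section AffineMaps.
Context {R : realType} {n : nat} {M : affine_manifold R n}.
Local Open Scope classical_set_scope.
Local Open Scope ring_scope.
Implicit Types (c d e : chart R M n) (p : M) (f : M -> M).

Lemma affine_atlas c : affine_chart c -> atlas c.
Proof. by case. Qed.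

Lemma affine_is_chart c : affine_chart c -> is_chart c.
Proof. by move=> /affine_atlas/atlas_chart. Qed.

(* The Christoffel symbols vanish in both charts, so the change-of-chart formula
   says that the second derivatives of the transition map vanish. *)
Lemma affine_transition c d p : affine_chart c -> affine_chart d ->
  cdom c p -> cdom d p ->
  exists A b, \forall x \near c p, transition c d x = x *m A + b.
Proof.
move=> [Ac c0] [Ad d0] cp dp.
exists ('J (transition c d) (c p)).
exists (transition c d (c p) - c p *m 'J (transition c d) (c p)).
apply: (smooth_locally_affine (overlap_open (atlas_chart Ac) (atlas_chart Ad))).
- exact: atlas_smooth.
- move=> _ [q [cq dq] <-] i j a.
  have := christoffel_change (am_conn M) Ac Ad cq dq i j a; cbv zeta.
  rewrite big1 => [|k _]; last by rewrite c0 ?mul0r//; exists q.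
  rewrite big1 => [|k _]; last by rewrite big1// => l _; rewrite d0 ?mul0r//; exists q.
  by rewrite add0r => <-.
- by exists p.
Qed.

(** A germ at [c p]. The two domain conditions keep [cinv c] and [d] meaningful, as both are
    arbitrary outside the charts. *)
Definition affine_at f c d p (A : 'M[R]_n) (b : 'rV[R]_n) :=
  \forall x \near c p,
    [/\ cimg c x, cdom d (f (cinv c x)) & local_expr c d f x = x *m A + b].

Lemma affine_map_continuous f : affine_map f -> continuous f.
Proof.
move=> af p; have [c [d [U [A [b [ac ad [oU Up] Ucd fA]]]]]] := af p.
have [cp dp] := Ucd _ Up.
have [_ _ _ cc _] := affine_is_chart ac.
have [_ _ dK _ cd] := affine_is_chart ad.
have ct : {for c p, continuous (fun x : 'rV[R]_n => x *m A + b : 'rV[R]_n)}.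
  exact/differentiable_continuous/(smooth_on_affine (U := setT) A b [::]).
have H : cinv d (c q *m A + b) @[q --> p] --> cinv d (c p *m A + b).
  apply: (cvg_comp (fun q => c q *m A + b) (cinv d)); last first.
    by apply: cd; rewrite -fA//; exists (f p).
  exact: (cvg_comp c (fun x => x *m A + b) (cc _ cp) ct).
rewrite -(fA _ Up) (dK _ dp) in H.
apply: cvg_trans H; apply: near_eq_cvg.
apply: filterS (open_nbhs_nbhs (conj oU Up)) => q Uq.
by rewrite -fA// dK//; have [] := Ucd _ Uq.
Qed.

(** The definition of [affine_map] supplies a single pair of charts around [p]; affine transition
    maps on both sides carry the formula to any other pair. *)
Lemma affine_map_at f c d p : affine_map f -> affine_chart c -> affine_chart d ->
  cdom c p -> cdom d (f p) -> exists A b, affine_at f c d p A b.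
Proof.
move=> af ac ad cp dp.
have [c0 [d0 [U [A0 [b0 [ac0 ad0 [oU Up] Ucd fA]]]]]] := af p.
have [c0p d0p] := Ucd _ Up.
have [A1 [b1 T1]] := affine_transition ac ac0 cp c0p.
have [A2 [b2 T2]] := affine_transition ad0 ad d0p dp.
have [_ _ _ cont_d0 _] := affine_is_chart ad0.
have cf := affine_map_continuous af.
have fd : \forall q \near p, cdom d (f q).
  exact: (cf p _ (cdom_nbhs (affine_is_chart ad) dp)).
have T2f : \forall q \near p, transition d0 d (d0 (f q)) = d0 (f q) *m A2 + b2.
  exact: (cf p _ (cont_d0 _ d0p _ T2)).
have UT := open_nbhs_nbhs (conj oU Up).
have N : \forall q \near p, cdom d (f q) /\
    (transition d0 d (d0 (f q)) = d0 (f q) *m A2 + b2 /\ U q).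
  by apply: filterI => //; exact: filterI.
have C := chart_nbhs (affine_is_chart ac) cp N.
exists (A1 *m A0 *m A2), ((b1 *m A0 + b0) *m A2 + b2).
apply: filterS2 T1 C => x T1x [cx [fx [T2x Ux]]]; split => //.
have [_ d0q] := Ucd _ Ux.
have [_ _ d0K _ _] := affine_is_chart ad0.
have := T2x; rewrite /transition /= (d0K _ d0q) => E.
rewrite -[LHS]/(d (f (cinv c x))) E.
rewrite (fA _ Ux) -[c0 (cinv c x)]/(transition c c0 x) T1x.
by rewrite !mulmxA !mulmxDl -!addrA.
Qed.

Lemma affine_at_jacobian f c d p A b : affine_at f c d p A b ->
  differentiable (local_expr c d f) (c p) /\ 'J (local_expr c d f) (c p) = A.
Proof. by move=> fA; apply: (@near_affine_jacobian _ _ _ _ _ A b); apply: filterS fA => x []. Qed.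

(** With [A] invertible, solving [x A + b = y] for [x] gives an affine [g], and [f'] reads as [g] in
    the charts near [q]. *)
Lemma affine_map_inverse f f' : cancel f f' -> cancel f' f -> affine_map f ->
  (forall p, exists2 c, affine_chart c & cdom c p) ->
  (forall c d p A b, affine_chart c -> affine_chart d -> cdom c p -> cdom d (f p) ->
     affine_at f c d p A b -> A \in unitmx) ->
  affine_map f'.
Proof.
move=> fK f'K af cover fu q; set p := f' q.
have [c ac cp] := cover p; have [d ad dq] := cover q.
have dfp : cdom d (f p) by rewrite /p f'K.
have [A [b fA]] := affine_map_at af ac ad cp dfp.
have uA := fu _ _ _ _ _ ac ad cp dfp fA.
have [_ _ dK cont_d _] := affine_is_chart ad.
have [_ _ cK _ _] := affine_is_chart ac.
pose g y := y *m invmx A + - (b *m invmx A).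
have gK y : g y *m A + b = y.
  by rewrite /g mulmxDl mulNmx !mulmxKV// subrK.
have gq : g (d q) = c p.
  have [_ _] := nbhs_singleton fA; rewrite /local_expr /= cK// f'K => ->.
  by rewrite /g mulmxDl mulmxK// addrK.
have gc : {for d q, continuous g}.
  exact/differentiable_continuous/(smooth_on_affine (U := setT) _ _ [::]).
have fA' : \forall r \near q, cdom d r /\ [/\ cimg c (g (d r)), cdom d (f (cinv c (g (d r))))
    & local_expr c d f (g (d r)) = g (d r) *m A + b].
  apply: filterI; first exact: cdom_nbhs (affine_is_chart ad) dq.
  have fA1 : \forall x \near g (d q), [/\ cimg c x, cdom d (f (cinv c x))
      & local_expr c d f x = x *m A + b] by rewrite gq.
  exact: (cont_d _ dq _ (gc _ fA1)).
have [V [oV Vq] VS] : exists2 B, open_nbhs q B & B `<=` [set r | cdom d r /\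
    [/\ cimg c (g (d r)), cdom d (f (cinv c (g (d r))))
    & local_expr c d f (g (d r)) = g (d r) *m A + b]].
  by move: fA'; rewrite -nbhs_nearE nbhsE.
(* [f] sends the point with coordinates [g (d r)] to one with coordinates [d r], that is to [r];
   cancelling [f] gives [f' r]. *)
have Vf' r : V r -> f' r = cinv c (g (d r)).
  move=> /VS[dr [cr fr]]; rewrite gK /local_expr /= => E.
  by rewrite -[RHS]fK -(dK _ fr) E dK.
exists d, c, V, (invmx A), (- (b *m invmx A)); split => //.
  move=> r Vr; have [dr [cr _ _]] := VS _ Vr; split => //=.
  by rewrite Vf'//; have [] := cinvK (affine_is_chart ac) cr.
by move=> r Vr; rewrite Vf'//; have [_ [cr _ _]] := VS _ Vr;
  have [] := cinvK (affine_is_chart ac) cr.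
Qed.

(** Where affine charts cover [M], this determines [Tf], because a vector is known from its
    components in one chart. *)
Definition is_tangent_map f (Tf : tangent M -> tangent M) :=
  forall X, tbase (Tf X) = f (tbase X) /\
    forall c d, affine_chart c -> affine_chart d ->
      cdom c (tbase X) -> cdom d (f (tbase X)) ->
      tcomp (Tf X) d = tcomp X c *m 'J (local_expr c d f) (c (tbase X)).

(** Chain rule for passing from [c] to [c0], applying [f], and passing from [d0] to [d]; it makes
    the tangent map independent of the charts used to build it. *)
Lemma jacobian_local_expr f c d c0 d0 p : affine_map f ->
  affine_chart c -> affine_chart d -> affine_chart c0 -> affine_chart d0 ->
  cdom c p -> cdom d (f p) -> cdom c0 p -> cdom d0 (f p) ->
  'J (local_expr c d f) (c p) =
  'J (transition c c0) (c p) *m 'J (local_expr c0 d0 f) (c0 p)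
    *m 'J (transition d0 d) (d0 (f p)).
Proof.
move=> af ac ad ac0 ad0 cp dp c0p d0p.
have [A0 [b0 fA0]] := affine_map_at af ac0 ad0 c0p d0p.
have [A [b fA]] := affine_map_at af ac ad cp dp.
have [df _] := affine_at_jacobian fA.
have [df0 _] := affine_at_jacobian fA0.
have [Ac Ad] := (affine_atlas ac, affine_atlas ad).
have [Ac0 Ad0] := (affine_atlas ac0, affine_atlas ad0).
have dt1 := transition_differentiable Ac Ac0 cp c0p.
have dt2 := transition_differentiable Ad0 Ad d0p dp.
have E1 : transition c c0 (c p) = c0 p := transitionE c0 Ac cp.
have E2 : local_expr c0 d0 f (c0 p) = d0 (f p).
  by rewrite /local_expr /=; have [_ _ cK _ _] := affine_is_chart ac0; rewrite cK.
rewrite -E1 in df0 E2 *; rewrite -E2 in dt2 *.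
have dc := differentiable_comp dt1 df0.
rewrite -(jacobian_comp dt1 df0) -(jacobian_comp dc dt2).
apply: near_eq_jacobian df.
have fd0 : \forall q \near p, cdom d0 (f q).
  exact: (affine_map_continuous af (cdom_nbhs (affine_is_chart ad0) d0p)).
have N : \forall q \near p, cdom c0 q /\ cdom d0 (f q).
  by apply: filterI => //; exact: cdom_nbhs (affine_is_chart ac0) c0p.
apply: filterS (chart_nbhs (affine_is_chart ac) cp N) => x [_ [c0x d0x]].
rewrite /transition /local_expr /=.
have [_ _ c0K _ _] := affine_is_chart ac0; rewrite (c0K _ c0x).
by have [_ _ d0K _ _] := affine_is_chart ad0; rewrite (d0K _ d0x).
Qed.

Lemma tangent_map_exists f : affine_map f ->
  (forall p, exists2 c, affine_chart c & cdom c p) ->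
  exists Tf, is_tangent_map f Tf.
Proof.
move=> af cover; have /choice[Tf HTf] : forall X : tangent M, exists Y : tangent M,
    tbase Y = f (tbase X) /\ forall c d, affine_chart c -> affine_chart d ->
      cdom c (tbase X) -> cdom d (f (tbase X)) ->
      tcomp Y d = tcomp X c *m 'J (local_expr c d f) (c (tbase X)); last by exists Tf.
move=> X.
have [c0 ac0 c0p] := cover (tbase X); have [d0 ad0 d0p] := cover (f (tbase X)).
have [Y [Yb Yc]] := tangent_exists
  (tcomp X c0 *m 'J (local_expr c0 d0 f) (c0 (tbase X))) (affine_atlas ad0) d0p.
exists Y; split; first exact: Yb.
move=> c d ac ad cp dp.
have d0Y : cdom d0 (tbase Y) by rewrite Yb.
have dY : cdom d (tbase Y) by rewrite Yb.
rewrite (tcomp_change (affine_atlas ad0) (affine_atlas ad) d0Y dY) Yc Yb.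
rewrite (tcomp_change (affine_atlas ac) (affine_atlas ac0) cp c0p).
rewrite (jacobian_local_expr af ac ad ac0 ad0 cp dp c0p d0p).
have assoc (v : 'rV[R]_n) (J1 J2 J3 : 'M[R]_n) :
  v *m J1 *m J2 *m J3 = v *m (J1 *m J2 *m J3) by rewrite !mulmxA.
exact: assoc.
Qed.

(** [local_expr c d id] is [transition c d]. Hence the coordinate changes of the tangent bundle and
    the transformation rule of [gT] are the case [f = id] of results on tangent maps. *)
Lemma tangent_map_id : is_tangent_map id id.
Proof.
move=> X; split; first by [].
move=> c d ac ad cp dp; exact: tcomp_change (affine_atlas ac) (affine_atlas ad) cp dp.
Qed.

Lemma tangent_map_local f Tf c d X A b : is_tangent_map f Tf ->
  affine_chart c -> affine_chart d -> cdom c (tbase X) ->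
  affine_at f c d (tbase X) A b ->
  \forall y \near tcoord c X, [/\ cimg (tangent_chart c) y,
    cdom (tangent_chart d) (Tf (cinv (tangent_chart c) y)) &
    local_expr (tangent_chart c) (tangent_chart d) Tf y = cplx_affine A b y].
Proof.
move=> Tff ac ad cX fA.
have Ac := affine_atlas ac.
(* The Jacobian is needed at every point near [c (tbase X)], so the affine form is required around
   each of these points. *)
have fA2 : \forall x \near c (tbase X), \forall x' \near x,
    [/\ cimg c x', cdom d (f (cinv c x')) & local_expr c d f x' = x' *m A + b].
  exact: nbhs_interior fA.
rewrite -lsubmx_tcoord in fA2.
have H : \forall y \near tcoord c X, \forall x' \near lsubmx y,
    [/\ cimg c x', cdom d (f (cinv c x')) & local_expr c d f x' = x' *m A + b].
  exact: (@continuous_lsubmx _ _ _ _ (tcoord c X) _ fA2).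
apply: filterS H => y Hy; have [cy dy fy] := nbhs_singleton Hy.
have iy : cimg (tangent_chart c) y by apply/(tangent_cimgE y Ac).
split => //.
  have [cZ Zy Zb] := tangent_cinvK Ac iy.
  by have [Tb _] := Tff (cinv (tangent_chart c) y); rewrite /= Tb Zb.
have [cZ Zy Zb] := tangent_cinvK Ac iy.
set Z := cinv _ y in cZ Zy Zb *.
have [Tb Tc] := Tff Z.
have dZ : cdom d (f (tbase Z)) by rewrite Zb.
rewrite /local_expr /= -/Z /tcoord Tb (Tc c d ac ad cZ dZ) /cplx_affine.
have HA : affine_at f c d (tbase Z) A b.
  by rewrite /affine_at -lsubmx_tcoord Zy.
have [_ ->] := affine_at_jacobian HA.
by rewrite Zb -[d _]/(local_expr c d f (lsubmx y)) fy -Zy lsubmx_tcoord rsubmx_tcoord.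
Qed.

End AffineMaps.

(** * Tangent maps as biholomorphisms of the tangent bundle, smooth in time *)

Section TangentBundleComplex.
Context {R : realType} {n : nat} {M : affine_manifold R n}.
Local Open Scope classical_set_scope.
Local Open Scope ring_scope.
Local Open Scope complex_scope.
Implicit Types (c d : chart R M n) (p : M) (f : M -> M) (g : tensor2 M).
Local Notation TM := (@TM_chart R n M).

Hypothesis cover : forall p, exists2 c, affine_chart c & cdom c p.

Lemma affine_map_id : affine_map (@id M).
Proof.
move=> p; have [c ac cp] := cover p.
exists c, c, (cdom c), 1%:M, 0; split => //.
- by split => //; case: (affine_is_chart ac).
- by move=> q _; rewrite mulmx1 addr0.
Qed.

Lemma TM_complex_manifold : complex_manifold TM.
Proof.
split.
- by split; [exact: tangent_hausdorff|exact: tangent_second_countable].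
- by move=> [c ac]; exact: is_chart_tangent (affine_atlas ac).
- move=> X; have [c ac cX] := cover (tbase X).
  by exists (exist _ c ac).
- move=> [c ac] [d ad]; apply: cplx_affine_holomorphic => _ [X [cX dX] <-].
  have [A [b idA]] := affine_map_at affine_map_id ac ad cX dX.
  exists A, b.
  by apply: filterS (tangent_map_local tangent_map_id ac ad cX idA) => y [].
Qed.

Lemma tangent_map_holomorphic f Tf : affine_map f -> is_tangent_map f Tf ->
  holomorphic_map TM Tf.
Proof.
move=> af Tff X [c ac] [d ad] cX dX.
have dfX : cdom d (f (tbase X)) by have [<- _] := Tff X.
have [A [b fA]] := affine_map_at af ac ad cX dfX.
have H := tangent_map_local Tff ac ad cX fA.
(* Each point of the interior has a whole neighbourhood on which [Tf] is complex affine with the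
   same [A] and [b]. *)
exists (interior [set y | [/\ cimg (tangent_chart c) y,
  cdom (tangent_chart d) (Tf (cinv (tangent_chart c) y)) &
  local_expr (tangent_chart c) (tangent_chart d) Tf y = cplx_affine A b y]]); split.
- exact: open_interior.
- exact: H.
- by move=> y /interior_subset[].
- by move=> y /interior_subset[].
- apply: cplx_affine_holomorphic => w Hw; exists A, b.
  by apply: filterS Hw => y [].
Qed.

Lemma tangent_map_unique f Tf Tf' : is_tangent_map f Tf -> is_tangent_map f Tf' -> Tf = Tf'.
Proof.
move=> H H'; apply/funext => X.
have [c ac cX] := cover (tbase X); have [d ad dfX] := cover (f (tbase X)).
have [Eb Ec] := H X; have [Eb' Ec'] := H' X.
apply: (tangent_eq (affine_atlas ad)); first by rewrite Eb.
  by rewrite Eb Eb'.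
by rewrite (Ec c d ac ad cX dfX) (Ec' c d ac ad cX dfX).
Qed.

(** In charts the Jacobians of [f] and [f'] multiply to that of [f' \o f], which is the identity. *)
Lemma tangent_map_cancel f f' Tf Tf' : affine_map f -> affine_map f' -> cancel f f' ->
  is_tangent_map f Tf -> is_tangent_map f' Tf' -> cancel Tf Tf'.
Proof.
move=> af af' fK H H' X.
have [c ac cX] := cover (tbase X); have [d ad dfX] := cover (f (tbase X)).
have [Eb Ec] := H X; have [Eb' Ec'] := H' (Tf X).
have bX : tbase (Tf' (Tf X)) = tbase X by rewrite Eb' Eb fK.
apply: (tangent_eq (affine_atlas ac)) => //; first by rewrite bX.
have dTX : cdom d (tbase (Tf X)) by rewrite Eb.
have cTX : cdom c (f' (tbase (Tf X))) by rewrite Eb fK.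
rewrite (Ec' d c ad ac dTX cTX) (Ec c d ac ad cX dfX) Eb.
have [A [b fA]] := affine_map_at af ac ad cX dfX.
have cfX : cdom c (f' (f (tbase X))) by rewrite fK.
have [A' [b' fA']] := affine_map_at af' ad ac dfX cfX.
have [df _] := affine_at_jacobian fA; have [df' _] := affine_at_jacobian fA'.
have [_ _ cK _ _] := affine_is_chart ac.
have E : local_expr c d f (c (tbase X)) = d (f (tbase X)).
  by rewrite /local_expr /= cK.
have N : \forall x \near c (tbase X),
    (local_expr d c f' \o local_expr c d f) x = x *m 1%:M + 0.
  apply: filterS fA => x [cx dx _]; rewrite mulmx1 addr0 /local_expr /=.
  have [_ _ dK _ _] := affine_is_chart ad; rewrite (dK _ dx) fK.
  by have [] := cinvK (affine_is_chart ac) cx.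
have [_ J1] := near_affine_jacobian N.
rewrite -E in df' *.
have assoc (v : 'rV[R]_n) (J J' : 'M[R]_n) : J *m J' = 1%:M -> v *m J *m J' = v.
  by move=> JJ'; rewrite -mulmxA JJ' mulmx1.
by apply: assoc; rewrite -(jacobian_comp df df').
Qed.

Lemma tangent_map_biholomorphism f f' Tf : affine_map f -> affine_map f' ->
  cancel f f' -> cancel f' f -> is_tangent_map f Tf -> biholomorphism TM Tf.
Proof.
move=> af af' fK f'K H; have [Tf' H'] := tangent_map_exists af' cover.
exists Tf'; split.
- exact: tangent_map_cancel H H'.
- exact: tangent_map_cancel H' H.
- exact: tangent_map_holomorphic H.
- exact: tangent_map_holomorphic H'.
Qed.

Lemma adjmx_real m k (A : 'M[R]_(m, k)) :
  adjmx (map_mx (fun a => a%:C) A) = map_mx (fun a => a%:C) A^T.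
Proof. by apply/matrixP => i j; rewrite !mxE conjc_real. Qed.

(** In affine charts the complex Jacobian of [Tf] and the real Jacobian of [f] are the same matrix
    [A], so the formula for [gT] is the real one with its entries embedded in the complex
    numbers. *)
Lemma gT_scaled_pullback s f Tf g h : affine_map f -> is_tangent_map f Tf ->
  is_scaled_pullback s f g h -> is_scaled_pullbackC TM s Tf (gT g) (gT h).
Proof.
move=> af Tff pf [c ac] [d ad] X cX dX.
have dfX : cdom d (f (tbase X)) by have [<- _] := Tff X.
have [A [b fA]] := affine_map_at af ac ad cX dfX.
have [_ JA] := affine_at_jacobian fA.
have N : \forall y \near tcoord c X,
    local_expr (tangent_chart c) (tangent_chart d) Tf y = cplx_affine A b y.
  by apply: filterS (tangent_map_local Tff ac ad cX fA) => y [].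
cbv zeta; rewrite /TM_chart /= (cplx_affine_jacobian N) adjmx_real /gT /=.
rewrite !lsubmx_tcoord (pf c d _ (affine_atlas ac) (affine_atlas ad) cX dfX) JA.
have [-> _] := Tff X.
by rewrite map_mxZ !map_mxM.
Qed.

(** The local extension [F] of [phi] agrees with it only for times in [I]. The fibre part of [Tphi]
    uses derivatives of [F] in the directions [(0, delta_mx 0 j)], and these see a single time
    slice, on which [F] and [phi] agree. *)
Lemma smooth_family_tangent (I : set R) (k : R) (phi : R -> M -> M)
    (Tphi : R -> tangent M -> tangent M) :
  smooth_family (@atlas R n M) I phi ->
  (forall t, I t -> affine_map (phi t)) ->
  (forall t, I (t / k) -> is_tangent_map (phi (t / k)) (Tphi t)) ->
  smooth_family (range TM) [set t | I (t / k)] Tphi.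
Proof.
move=> sphi aphi HT t X _ _ It [[c ac] _ <-] [[d ad] _ <-] /= cX dX.
have dfX : cdom d (phi (t / k) (tbase X)) by have [<- _] := HT t It X.
have [W [F [oW Wt sF WF]]] :=
  sphi _ _ _ _ It (affine_atlas ac) (affine_atlas ad) cX dfX.
(* [L] rescales time and forgets the fibre; the fibre coordinates enter through [y]. *)
pose L (z : R * 'rV[R]_(n + n)) : R * 'rV[R]_n := (z.1 / k, lsubmx z.2).
pose y (z : R * 'rV[R]_(n + n)) := rsubmx z.2.
have linL : linear L.
  by move=> a u v; rewrite /L /= mulrDl -scalerAl lsubmx_linear.
have liny : linear y by move=> a u v; rewrite /y /= rsubmx_linear.
have cL : continuous L.
  move=> z.
  have c1 : {for z, continuous (fun z : R * 'rV[R]_(n + n) => z.1 / k)}.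
    by apply: cvgM; [exact: cvg_fst|exact: cvg_cst].
  have c2 : {for z, continuous (fun z : R * 'rV[R]_(n + n) => lsubmx z.2)}.
    by apply: continuous_comp; [exact: cvg_snd|exact: continuous_lsubmx].
  exact: cvg_pair c1 c2.
have cy : continuous y.
  move=> z; apply: continuous_comp; [exact: cvg_snd|exact: continuous_rsubmx].
exists (L @^-1` W), (fun z => row_mx (F (L z))
  (\sum_j y z 0 j *: 'D_((0, delta_mx 0 j)) F (L z))); split.
- by apply: open_comp => // z _; exact: cL.
- by rewrite /L /= lsubmx_tcoord.
- exact: smooth_tangent_lift.
move=> s w Ww Is; have [cx dx Fx] := WF _ _ Ww Is.
have iw : cimg (tangent_chart c) w by apply/(tangent_cimgE w (affine_atlas ac)).
have [cZ Zw Zb] := tangent_cinvK (affine_atlas ac) iw.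
have [Tb Tc] := HT s Is (cinv (tangent_chart c) w).
split => //; first by rewrite /= Tb Zb.
set Z := cinv _ w in cZ Zw Zb Tb Tc *.
have dZ : cdom d (phi (s / k) (tbase Z)) by rewrite Zb.
have [A [b fA]] := affine_map_at (aphi _ Is) ac ad cZ dZ.
have [df _] := affine_at_jacobian fA.
rewrite /local_expr /= -/Z /tcoord Tb (Tc c d ac ad cZ dZ).
have cZE : c (tbase Z) = lsubmx w by rewrite -Zw lsubmx_tcoord.
have yE : tcomp Z c = rsubmx w by rewrite -Zw rsubmx_tcoord.
rewrite cZE in df *.
have dE : d (phi (s / k) (tbase Z)) = F (L (s, w)) by rewrite Zb /L /= Fx.
have DE v : 'D_v (local_expr c d (phi (s / k))) (lsubmx w) = 'd F (L (s, w)) (0, v).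
  have dF : differentiable F (L (s, w)) by exact: (sF [::]).
  transitivity ('D_v (fun x => F (s / k, x)) (lsubmx w)).
    apply: near_eq_derive.
    have cs : {for lsubmx w, continuous (fun x : 'rV[R]_n => (s / k, x))}.
      have c1 : {for lsubmx w, continuous (fun _ : 'rV[R]_n => s / k : R)}.
        exact: cst_continuous.
      have c2 : {for lsubmx w, continuous (@id 'rV[R]_n)} by exact: cvg_id.
      exact: cvg_pair c1 c2.
    have WN : \forall x \near lsubmx w, W (s / k, x).
      exact: (cs _ (open_nbhs_nbhs (conj oW Ww))).
    apply: filterS WN => x Wx.
    by have [_ _ ->] := WF _ _ Wx Is.
  rewrite -(deriveE _ dF) /derive.
  set g1 := fun h => _; set g2 := fun h => _; suff -> : g1 = g2 by [].
  apply/funext => h; rewrite /g1 /g2 /L /=; congr (_ *: (F _ - _)).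
  by congr pair; rewrite /= scaler0 add0r.
have dlin : linear (fun v : 'rV[R]_n => 'd F (L (s, w)) (0, v)).
  move=> a u v; rewrite -linearP; congr ('d F _ _).
  by congr pair; rewrite /= scaler0 addr0.
rewrite dE yE; congr row_mx.
have /= <- := deriveEjacobian (rsubmx w) df; rewrite DE.
rewrite (linear_rV_sum (rsubmx w) dlin); apply: eq_bigr => j _.
by rewrite deriveE//; exact: (sF [::]).
Qed.

End TangentBundleComplex.

(** * The metric on the tangent bundle *)

Section RealFunctions.
Context {R : realType} {n : nat}.
Local Open Scope classical_set_scope.
Local Open Scope ring_scope.
Local Open Scope complex_scope.

(* Without differentiability: if the difference quotients diverge, both sides are
   the default value [0] of [lim]. *)
Lemma derive_mull (V : normedModType R) (k : R) (f : V -> R) x v :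
  'D_v (fun y => k * f y) x = k * 'D_v f x.
Proof.
have [df|ndf] := pselect (derivable f x v); first exact: deriveMl.
have [->|k0] := eqVneq k 0.
  rewrite mul0r; under eq_fun do rewrite mul0r.
  exact: derive_cst.
have ndkf : ~ derivable (fun y => k * f y) x v.
  move=> dkf; apply: ndf.
  have -> : f = (fun y => k^-1 * (k * f y)) by apply/funext => y; rewrite mulKf.
  exact: (derivableM (derivable_cst k^-1 x v) dkf).
rewrite /derive (dvgP ndf) (dvgP ndkf).
by rewrite [point]/(0 : R) mulr0.
Qed.

Lemma derive_lsubmx (u : 'rV[R]_n -> R) (w : 'rV[R]_(n + n)) (a b : 'rV[R]_n) :
  'D_(row_mx a b) (fun y => u (lsubmx y)) w = 'D_a u (lsubmx w).
Proof.
rewrite -[LHS]/('D_(row_mx a b) (u \o lsubmx) w).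
by rewrite (derive_comp_lin _ _ _ (@lsubmx_linear R n n)) row_mxKl.
Qed.

Lemma dx_real j (u : 'rV[R]_n -> R) w :
  dx j (fun y => (u (lsubmx y))%:C) w = (partial j u (lsubmx w))%:C.
Proof.
rewrite /dx /deriveC /= (derive_lsubmx u).
by congr (_ +i* _); exact: derive_cst.
Qed.

Lemma dy_real j (u : 'rV[R]_n -> R) w : dy j (fun y => (u (lsubmx y))%:C) w = 0.
Proof.
rewrite /dy /deriveC /= (derive_lsubmx u) derive0.
by congr (_ +i* _); exact: derive_cst.
Qed.

Lemma dz_real j (u : 'rV[R]_n -> R) w :
  dz j (fun y => (u (lsubmx y))%:C) w = (2^-1 * partial j u (lsubmx w))%:C.
Proof.
by rewrite /dz dx_real dy_real mulr0 subr0 rmorphM /= mulrC fmorphV rmorph_nat.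
Qed.

Lemma dzbar_real j (u : 'rV[R]_n -> R) w :
  dzbar j (fun y => (u (lsubmx y))%:C) w = (2^-1 * partial j u (lsubmx w))%:C.
Proof.
by rewrite /dzbar dx_real dy_real mulr0 addr0 rmorphM /= mulrC fmorphV rmorph_nat.
Qed.

(** Each operator contributes a factor 1/2, since the function is constant along the fibres. *)
Lemma dz_dzbar_real a b (u : 'rV[R]_n -> R) w :
  dz a (dzbar b (fun y => (u (lsubmx y))%:C)) w =
  (4^-1 * partial a (partial b u) (lsubmx w))%:C.
Proof.
have -> : dzbar b (fun y => (u (lsubmx y))%:C) =
    (fun y => ((fun x => 2^-1 * partial b u x) (lsubmx y))%:C).
  by apply/funext => y; exact: dzbar_real.
rewrite (dz_real a (fun x => 2^-1 * partial b u x)) /partial derive_mull mulrA; congr ((_ * _)%:C).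
by rewrite -invfM -natrM.
Qed.

Lemma time_scale (T : \bar R) t : time (4%:E * T) t = time T (t / 4).
Proof.
apply/propext; rewrite /time /=.
have -> : ((t / 4)%:E < T)%E = (t%:E < 4%:E * T)%E.
  by rewrite mulrC EFinM lte_pdivrMl.
by rewrite pmulr_lge0 ?invr_gt0.
Qed.

Lemma is_deriv_within_rescale (I : set R) (f : R -> R) (k t l : R) : 0 < k ->
  is_deriv_within I f (t / k) l ->
  is_deriv_within [set s | I (s / k)] (fun s => f (s / k)) t (l / k).
Proof.
move=> k0; rewrite /is_deriv_within => H.
have kn0 : k != 0 by rewrite gt_eqF.
have sc : (fun s => s / k) @ within [set s | I (s / k)] (dnbhs t) -->
    within I (dnbhs (t / k)).
  move=> A; rewrite /within /= => -[e /= e0 He].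
  exists (e * k); first by rewrite /= mulr_gt0.
  move=> s /= se st Is; apply: He => //=.
    by rewrite -mulrBl normrM normfV (gtr0_norm k0) ltr_pdivrMr.
  by apply: contra st => /eqP /(mulIf (invr_neq0 kn0)) ->.
have -> : (fun s => (f (s / k) - f (t / k)) / (s - t)) =
   (fun s => (f (s / k) - f (t / k)) / (s / k - t / k) / k).
  apply/funext => s; rewrite -mulrBl invfM invrK -!mulrA; congr (_ * _).
  by rewrite mulfV ?mulr1.
apply: cvgM; last exact: cvg_cst.
exact: (cvg_comp (fun s => s / k) _ sc H).
Qed.

Lemma smooth_within_rescale (I : set R) (f : R -> R) (k : R) :
  smooth_within I f -> smooth_within [set s | I (s / k)] (fun s => f (s / k)).
Proof.
move=> sf t It; have [U [F [oU Ut sF FE]]] := sf _ It.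
have lin : linear (fun s : R => s / k).
  by move=> a u v; rewrite mulrDl -scalerAl.
have cont : continuous (fun s : R => s / k) by exact: mulrr_continuous.
exists ((fun s => s / k) @^-1` U), (F \o (fun s => s / k)); split => //.
- by apply: open_comp => // s _; exact: cont.
- exact: smooth_on_comp_lin.
- by move=> s Us Is; exact: FE.
Qed.

End RealFunctions.

(** * Positivity, closedness and the flow equation for [gT] *)

Section TangentMetric.
Context {R : realType} {n : nat} {M : affine_manifold R n}.
Local Open Scope classical_set_scope.
Local Open Scope ring_scope.
Local Open Scope complex_scope.
Implicit Types (c d : chart R M n) (p : M) (f : M -> M) (g : tensor2 M).
Local Notation TM := (@TM_chart R n M).

Hypothesis cover : forall p, exists2 c, affine_chart c & cdom c p.

(** For [v = x + i y] with real rows, the mixed terms cancel by symmetry of [G], and what remains is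
    [x G x^T + y G y^T] with [x] or [y] nonzero. *)
Lemma hermitian_pos (G : 'M[R]_n) (v : 'rV[R[i]]_n) : G^T = G ->
  (forall x : 'rV[R]_n, x != 0 -> 0 < (x *m G *m x^T) 0 0) -> v != 0 ->
  0 < (v *m map_mx (fun a => a%:C) G *m adjmx v) 0 0.
Proof.
move=> symG posG v0.
pose x := map_mx (@complex.Re R) v; pose y := map_mx (@complex.Im R) v.
pose C m k (A : 'M[R]_(m, k)) := map_mx (fun a : R => a%:C) A.
have vE : v = C _ _ x + 'i *: C _ _ y.
  by apply/rowP => j; rewrite !mxE; exact: complexE.
have avE : adjmx v = C _ _ x^T - 'i *: C _ _ y^T.
  apply/colP => j; rewrite !mxE; case: (v 0 j) => a b /=.
  by apply/eqP; rewrite eq_complex /=; apply/andP; split; apply/eqP; ring.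
have ge0 (z : 'rV[R]_n) : 0 <= (z *m G *m z^T) 0 0.
  have [->|z0] := eqVneq z 0; first by rewrite !mul0mx mxE.
  exact/ltW/posG.
have xy : (x *m G *m y^T) 0 0 = (y *m G *m x^T) 0 0.
  have -> : y *m G *m x^T = (x *m G *m y^T)^T.
    by rewrite !trmx_mul trmxK symG mulmxA.
  by rewrite [RHS]mxE.
have -> : (v *m C _ _ G *m adjmx v) 0 0 =
    ((x *m G *m x^T) 0 0 + (y *m G *m y^T) 0 0)%:C.
  rewrite avE {1}vE mulmxDl mulmxBr !mulmxDl -!scalemxAl -!scalemxAr.
  rewrite /C -!map_mxM scalerA -expr2 sqr_i scaleN1r.
  move: xy; move: (x *m G *m x^T) (x *m G *m y^T) (y *m G *m x^T) (y *m G *m y^T).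
  by move=> P Q S W QS; rewrite !mxE QS rmorphD /=; ring.
rewrite ltcR; have [x0|x0] := eqVneq x 0.
  apply: ltr_wpDl => //; apply: posG; apply: contraNneq v0 => y0.
  by rewrite vE x0 y0 /C !map_mx0 scaler0 addr0.
by apply: ltr_wpDr => //; exact: posG.
Qed.

(** The change-of-chart rule of a metric is pullback along [id]; in this form [gT_scaled_pullback]
    transfers it to [gT]. *)
Lemma scaled_pullback_id g : riemannian_metric g -> is_scaled_pullback 1 id g g.
Proof.
move=> [_ _ _ ch] c d p ac ad cp dp; cbv zeta.
by rewrite scale1r; exact: ch.
Qed.

Lemma gT_hermitian g : riemannian_metric g -> hermitian_metric TM (gT g).
Proof.
move=> rg; have [smg symg posg chg] := rg; split.
- move=> [c ac] a b; split.
    apply: (@smooth_on_sub _ _ _ (lsubmx @^-1` cimg c)).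
      by move=> y /(tangent_cimgE y (affine_atlas ac)).
    rewrite (_ : (fun _ => _) = (fun x => g c x a b) \o lsubmx).
      apply: smooth_on_comp_lin; [exact: lsubmx_linear|exact: continuous_lsubmx|].
      exact: smg (affine_atlas ac) a b.
    by apply/funext => y /=; rewrite mxE.
  rewrite (_ : (fun _ => _) = fun=> 0); first exact: smooth_on_cst.
  by apply/funext => y /=; rewrite mxE.
- move=> [c ac] w /(tangent_cimgE w (affine_atlas ac)) cw.
  by rewrite /gT adjmx_real /= symg//; exact: affine_atlas.
- move=> [c ac] w /(tangent_cimgE w (affine_atlas ac)) cw v v0.
  apply: hermitian_pos => //=; first by apply: symg => //; exact: affine_atlas.
  by move=> x x0; apply: posg => //; exact: affine_atlas.
- move=> [c ac] [d ad] X cX dX; cbv zeta.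
  have := gT_scaled_pullback (affine_map_id cover) (@tangent_map_id _ _ M)
    (scaled_pullback_id rg) (i := exist _ c ac) (j := exist _ d ad) cX dX.
  by cbv zeta; rewrite scale1r.
Qed.

(* [g = D_u D_v phi] in every affine chart, for [u], [v] constant vector fields. *)
Lemma hessian_closed g c x a b k : hessian_metric g -> affine_chart c -> cimg c x ->
  partial k (fun y => g c y a b) x = partial a (fun y => g c y k b) x.
Proof.
move=> [[_ _ _ chg] hess] ac [p cp <-].
have [d [U [phi [ad dp [oU Up Ui] sphi gphi]]]] := hess p.
have [A [v idA]] := affine_map_at (affine_map_id cover) ac ad cp dp.
pose T (y : 'rV[R]_n) := y *m A + v.
(* The potential [phi] lives in the chart [d]; [r j] is the [j]-th coordinate field of [c] written
   in [d], constant because the transition is affine near the point. *)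
pose r j := row j A.
have gU z i j : U z -> (A *m g d z *m A^T) i j = 'D_(r i) (fun y => 'D_(r j) phi y) z.
  move=> Uz; rewrite row_sum_partial; last exact: (smooth_on_derive (r j) sphi [::]).
  rewrite -mulmxA mxE; apply: eq_bigr => l _; rewrite !mxE; congr (_ * _).
  (* With [r j] as the outer direction, the derivative can be expanded linearly in it. *)
  rewrite (@derive_comm _ _ U phi z (delta_mx 0 l) (r j) oU sphi Uz).
  rewrite row_sum_partial; last exact: (smooth_on_derive (delta_mx 0 l) sphi [::]).
  apply: eq_bigr => m _.
  have -> : A^T m j = r j 0 m by rewrite [LHS]mxE [RHS]mxE.
  rewrite [LHS]mulrC; congr (_ * _).
  rewrite (gphi z Uz l m).
  exact: (@derive_comm _ _ U phi z (delta_mx 0 l) (delta_mx 0 m) oU sphi Uz).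
have Tp : T (c p) = d p.
  have [_ _] := nbhs_singleton idA; rewrite /T => <-.
  by rewrite /local_expr /=; have [_ _ cK _ _] := affine_is_chart ac; rewrite cK.
have TU : \forall y \near c p, U (T y).
  have cT : {for c p, continuous T}.
    exact/differentiable_continuous/(smooth_on_affine (U := setT) _ _ [::]).
  by apply: cT; rewrite Tp; exact: open_nbhs_nbhs.
have gE : \forall y \near c p, forall i j,
    g c y i j = 'D_(r i) (fun z => 'D_(r j) phi z) (T y).
  have idA2 := nbhs_interior idA.
  apply: filterS2 idA2 TU => y Hy UTy i j.
  have [cy dy Ty] := nbhs_singleton Hy.
  have [cq qy] := cinvK (affine_is_chart ac) cy.
  have idq : affine_at id c d (cinv c y) A v by rewrite /affine_at qy.
  have [_ JA] := affine_at_jacobian idq.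
  have := chg c d (affine_atlas ac) (affine_atlas ad) _ cq dy; cbv zeta.
  rewrite [X in X *m _ *m _]JA [X in _ *m X^T]JA qy => ->.
  by rewrite -gU//; congr ((_ *m g d _ *m _) i j); exact: Ty.
have DT (h : 'rV[R]_n -> R) i y : 'D_(delta_mx 0 i) (fun z => h (T z)) y = 'D_(r i) h (T y).
  rewrite /derive; set g1 := fun h => _; set g2 := fun h => _; suff -> : g1 = g2 by [].
  apply/funext => s; rewrite /g1 /g2 /T /=; congr (_ *: (h _ - _)).
  by rewrite mulmxDl -scalemxAl -rowE addrA.
have pE i j : partial i (fun y => g c y j b) (c p) =
    'D_(r i) (fun z => 'D_(r j) (fun z => 'D_(r b) phi z) z) (d p).
  rewrite -Tp -DT /partial; apply: near_eq_derive.
  by apply: filterS gE => y ->.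
(* Both sides are third derivatives of [phi] along [r k], [r a], [r b], with the two outer ones
   exchanged. *)
by rewrite !pE; exact: derive_comm (smooth_on_derive (r b) sphi) Up.
Qed.

Lemma gT_kahler g : hessian_metric g -> kahler_metric TM (gT g).
Proof.
move=> hg; split; first by apply: gT_hermitian; case: hg.
move=> [c ac] w /(tangent_cimgE w (affine_atlas ac)) cw k a b.
have E i j : (fun y => gT g (exist _ c ac) y i j) =
    (fun y => ((fun x => g c x i j) (lsubmx y))%:C).
  by apply/funext => y; rewrite mxE.
by rewrite !E (dz_real k (fun x => g c x a b)) (dz_real a (fun x => g c x k b))
  (hessian_closed _ _ _ hg ac cw).
Qed.

(** The determinant commutes with the embedding of the reals, and the factor 1/4 splits into 1/2 and
    the 1/2 contained in [koszul_form]. *)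
Lemma ricci_gT g c (ac : affine_chart c) w a b :
  ricci (gT g) (exist _ c ac) w a b = (- (2^-1 * koszul_form g c (lsubmx w) a b))%:C.
Proof.
rewrite /ricci /koszul_form.
have -> : (fun y => (ln (complex.Re (\det (gT g (exist _ c ac) y))))%:C) =
    (fun y => ((fun x => ln (\det (g c x))) (lsubmx y))%:C).
  apply/funext => y; rewrite /gT /=.
  by rewrite (det_map_mx (real_complex R) (g c (lsubmx y))).
rewrite (dz_dzbar_real a b (fun x => ln (\det (g c x)))) mulrA rmorphN; congr (- (_ * _)%:C).
by rewrite -invfM -natrM.
Qed.

Lemma gT_flow (T : \bar R) (g : R -> tensor2 M) : hesse_koszul_flow T g ->
  kahler_ricci_flow TM (4%:E * T) (fun t => gT (g (t / 4))).
Proof.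
move=> [hess flow]; split.
  by move=> t; rewrite time_scale => Tt; apply: gT_kahler; exact: hess.
move=> t [c ac] w a b; rewrite time_scale => Tt.
move=> /(tangent_cimgE w (affine_atlas ac)) cw.
have E : time (4%:E * T) = [set s | time T (s / 4)].
  by apply/funext => s; exact: time_scale.
rewrite ricci_gT E; split.
  have k4 : 0 < (4 : R) by [].
  have := is_deriv_within_rescale k4 (flow _ _ _ a b Tt ac cw).
  rewrite (_ : (fun s => complex.Re _) = (fun s => g (s / 4) c (lsubmx w) a b)).
    (* Slowing time by 4 makes the velocity [2 beta / 4 = beta / 2], which is [- Ric] by
       [ricci_gT]. *)
    rewrite (_ : complex.Re _ = 2 * koszul_form (g (t / 4)) c (lsubmx w) a b / 4) //=.
    by rewrite opprK; field.
  by apply/funext => s; rewrite mxE.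
rewrite (_ : (fun s => complex.Im _) = fun=> 0); last by apply/funext => s; rewrite mxE.
rewrite /= oppr0 /is_deriv_within (_ : (fun _ => _) = fun=> 0); first exact: cvg_cst.
by apply/funext => s; rewrite subrr mul0r.
Qed.

(** If [v A = 0], the value of [h] at [v] is [s] times that of [g] at [v A], hence zero, against
    positivity of [h] unless [v = 0]. *)
Lemma scaled_pullback_unitmx s f g h c d p A b : is_scaled_pullback s f g h ->
  riemannian_metric h -> affine_chart c -> affine_chart d -> cdom c p ->
  cdom d (f p) -> affine_at f c d p A b -> A \in unitmx.
Proof.
move=> pf [_ _ posh _] ac ad cp dp fA.
have [_ JA] := affine_at_jacobian fA.
have cpi : cimg c (c p) by exists p.
rewrite unitmxE unitfE; apply/negP => /det0P[v v0 vA].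
have := posh c (affine_atlas ac) _ cpi v v0.
rewrite (pf c d p (affine_atlas ac) (affine_atlas ad) cp dp) JA.
by rewrite -scalemxAr -scalemxAl !mulmxA vA !mul0mx scaler0 mxE ltxx.
Qed.

End TangentMetric.

(** * The soliton on the tangent bundle *)

Local Open Scope ring_scope.

Theorem theorem4p3 (R : realType) (n : nat) (M : affine_manifold R n)
    (T : \bar R) (hT : (0 < T)%E) (g : R -> tensor2 M)
    (hg : koszul_soliton T g) :
  complex_manifold (@TM_chart R n M) /\
  kahler_ricci_soliton (@TM_chart R n M) (4%:E * T)%E
    (fun t : R => gT (g (t / 4))).
Proof.
have [flow [phi [sigma [[sphi phi0] [ssigma sigma0] aphi pphi]]]] := hg.
have T0 : time T 0 by [].
(* The metric at time 0 is Hessian, and its local potentials come with affine charts. *)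
have cover p : exists2 c : chart R M n, affine_chart c & cdom c p.
  by have [_ /(_ p)[c [U [u [ac cp _ _ _]]]]] := flow.1 0 T0; exists c.
have E : time (4%:E * T)%E = [set s | time T (s / 4)]%classic.
  by apply: funext => s; exact: time_scale.
split; first exact: TM_complex_manifold.
split; first exact: gT_flow.
(* Outside the time interval nothing is known about [phi (t / 4)], and [psi t] is set to [id]. *)
have /choice[psi Hpsi] : forall t, exists Tf : tangent M -> tangent M,
    time T (t / 4) -> is_tangent_map (phi (t / 4)) Tf.
  move=> t; have [Tt|nTt] := pselect (time T (t / 4)); last by exists id.
  have [Tf HTf] := tangent_map_exists (aphi _ Tt).2 cover.
  by exists Tf.
exists psi, (fun t => sigma (t / 4)); split.
- split.
    rewrite E; apply: (smooth_family_tangent sphi _ Hpsi) => t Tt.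
    exact: (aphi t Tt).2.
  (* [psi 0] comes from a choice, but both it and [id] are tangent maps of [phi 0 = id]. *)
  apply: (tangent_map_unique cover _ (@tangent_map_id _ _ M)).
  by have := Hpsi 0; rewrite mul0r phi0; exact.
- by rewrite E mul0r; split => //; exact: smooth_within_rescale.
- move=> t; rewrite time_scale => Tt.
  have [[f' fK f'K] af] := aphi _ Tt.
  have af' : affine_map f'.
    apply: (affine_map_inverse fK f'K af cover) => c d p A b ac ad cp dp.
    exact: (scaled_pullback_unitmx (pphi _ Tt) (flow.1 _ Tt).1).
  exact: (tangent_map_biholomorphism cover af af' fK f'K (Hpsi t Tt)).
- move=> t; rewrite time_scale => Tt; rewrite mul0r.
  exact: gT_scaled_pullback (aphi _ Tt).2 (Hpsi t Tt) (pphi _ Tt).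
Qed.
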